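(* Let $\pi=(d_1,\dots,d_n)$ be a graphic sequence with $d_1\ge d_2\ge\cdots\ge d_n$. Then there exists a simple graph $G$ with vertex set $V(G)=\{v_1,\dots,v_n\}$ and $d_G(v_i)=d_i$ for all $i\in[n]$ such that, if $H$ denotes the parity bisection of $G$ (with respect to this labeling), then $d_H(v_i)\ge (d_G(v_i)-1)/2$ for all $i\in[n]$.
   Context: A sequence of nonnegative integers is graphic if it is the degree sequence of some finite simple graph. $[k]=\{1,\dots,k\}$. For a graph $G$ with vertices labeled $V(G)=\{v_1,\dots,v_n\}$, the parity bisection of $G$ is the spanning bipartite subgraph $H$ with partition sets $V_1=\{v_j: j \text{ odd}\}$ and $V_2=\{v_j: j\text{ even}\}$ and edge set $E(H)=\{uv\in E(G): u\in V_1, v\in V_2\}$. $d_G(v)$ denotes the degree of $v$ in $G$. *)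

(* Defs.v *)
(* Vertices v_1..v_n are represented by 'I_n, with
   ordinal i standing for v_(i+1). *)
From mathcomp Require Import all_boot.
Set Implicit Arguments. Unset Strict Implicit. Unset Printing Implicit Defensive.

Definition simple_graph (n : nat) (e : rel 'I_n) : Prop :=
  (forall u v, e u v = e v u) /\ (forall v, ~~ e v v).

Definition deg (n : nat) (e : rel 'I_n) (v : 'I_n) : nat := #|[set u | e v u]|.

Definition graphic (n : nat) (d : 'I_n -> nat) : Prop :=
  exists e : rel 'I_n, simple_graph e /\ forall i, deg e i = d i.

(* Parity classes: v_j with j odd is ordinal j-1 even. V1 = {i : ~~ odd i},
   V2 = {i : odd i} (0-based). An edge uv lies in the parity bisection iff
   its endpoints have different parity. *)
Definition parity_bisection (n : nat) (e : rel 'I_n) : rel 'I_n :=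
  fun u v => e u v && (odd u != odd v).

(* Main.v *)
(** Call a realization balanced when every vertex v has
    same v <= cross v + [v of the class of vertex 0], where same and cross count the
    neighbours of v in its own parity class and in the other one; this implies the
    bound of the theorem.  A last vertex of degree 0 or a dominating first vertex can
    be removed (in the second case the classes are swapped, which the definition
    tolerates).  Otherwise some i < n has d + e_i - e_n graphic; take i minimal.
    The new sequence is smaller for sum v * d v, so it has a balanced realization G
    by induction, and it remains to carry one unit of degree from i to n in G by
    moves x-w -> y-w without destroying balance.  Minimality of i makes every vertex
    with a neighbour in the tail [i, n] adjacent to the whole head [0, i), which
    expresses the slack of such a vertex through its tail neighbours only.  If no
    sequence of moves works, then double counting of the edges meeting the tail
    contradicts the monotonicity of the degrees. *)
From Stdlib Require Import Classical_Prop.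
Require Import Defs.
From mathcomp Require Import all_boot zify.

Set Implicit Arguments. Unset Strict Implicit. Unset Printing Implicit Defensive.


(** The bit [~~ odd v] fits the removal of a dominating vertex 0: putting it back shifts all indices
    by one, so it becomes a same-class neighbour of exactly the vertices that acquire the allowance,
    and a neighbour across for those that lose it. Call [cross e v + ~~ odd v - same e v] the slack
    of v, and v tight when it is 0. A move x-w -> y-w with x and y in one class does not touch the
    slack of w, so a degree gap between x and y is enough to find it. With x and y in different
    classes the slack of w changes by two, upwards only if w is in the class of x. Hence the split
    by the parities of i and n: when they differ, the unit must cross between the classes once, and
    some w has to pay for it. A missing move bounds the slack of tail vertices from one side. Summed
    over the tail, such bounds leave the range allowed for alternating sums of a nonincreasing
    sequence; when neither i nor n is tight, edges inside the two halves of the tail are compared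
    instead. *)

Ltac olia := clear; repeat match goal with
  |- context [odd (nat_of_ord ?x)] => generalize (odd (nat_of_ord x)); intro end; lia.

(** * Neighbour counts by class and the edge move *)

Definition nbr n (e : rel 'I_n) (A : pred 'I_n) (v : 'I_n) : nat :=
  \sum_(u | A u) e v u.

Definition cls n (o : bool) : pred 'I_n := fun u => odd u == o.

Definition same n (e : rel 'I_n) (v : 'I_n) := nbr e (cls (odd v)) v.
Definition cross n (e : rel 'I_n) (v : 'I_n) := nbr e (cls (~~ odd v)) v.

Definition balanced n (e : rel 'I_n) :=
  forall v, same e v <= cross e v + ~~ odd v.

Definition move n (e : rel 'I_n) (x w y : 'I_n) : rel 'I_n := fun u v =>
  (e u v && ~~ ((u == x) && (v == w) || (u == w) && (v == x)))
  || ((u == y) && (v == w) || (u == w) && (v == y)).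

Lemma sum_indic n (A : pred 'I_n) (w : 'I_n) (k : nat) :
  \sum_(u | A u) (k * (u == w)) = k * A w.
Proof.
rewrite -big_distrr /=; congr (_ * _).
rewrite big_mkcond (bigD1 w) //= eqxx big1 ?addn0; first by case: (A w).
by move=> u /negbTE ->; case: (A u).
Qed.

Lemma nbrT n (e : rel 'I_n) v : nbr e predT v = deg e v.
Proof. by rewrite /nbr /deg cardsE -sum1_card [RHS]big_mkcond /=; apply: eq_bigr => u _; rewrite unfold_in; case: (e v u). Qed.

Lemma deg_cls n (e : rel 'I_n) v : deg e v = same e v + cross e v.
Proof.
rewrite -nbrT /same /cross /nbr /cls (bigID (fun u : 'I_n => odd u == odd v)) /=.
by congr (_ + _); apply: eq_bigl => u; case: (odd u); case: (odd v).
Qed.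

Section Move.
Variables (n : nat) (e : rel 'I_n) (x w y : 'I_n).
Hypothesis (se : simple_graph e) (exw : e x w) (eyw : ~~ e y w) (yw : y != w).

Lemma move_neq : x != w /\ x != y.
Proof.
case: se => _ ir; split; apply/eqP => h.
  by move: (ir w); rewrite -{1}h exw.
by move: eyw; rewrite -h exw.
Qed.

Lemma move_simple : simple_graph (move e x w y).
Proof.
case: se => sy ir; split=> [u v|v]; rewrite /move.
  by rewrite sy; do 6!case: eqVneq => ?.
rewrite (negbTE (ir v)) /=.
by case: (eqVneq v y) => [->|_] /=; rewrite ?(negbTE yw) ?andbF.
Qed.

Lemma nbr_move (A : pred 'I_n) v :
  nbr (move e x w y) A v + (v == x) * A w + (v == w) * A x =
  nbr e A v + (v == y) * A w + (v == w) * A y.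
Proof.
have [xw xy] := move_neq; case: (se) => sy ir.
rewrite -!(sum_indic A) /nbr -!big_split /=; apply: eq_bigr => u _.
rewrite /move.
case: (eqVneq v x) => [->|vx].
  rewrite (negbTE xw) (negbTE xy) /= orbF.
  by case: (eqVneq u w) => [->|uw] /=; rewrite ?exw ?andbT ?muln0.
case: (eqVneq v w) => [->|vw] /=.
  rewrite (eq_sym w y) (negbTE yw) /=.
  case: (eqVneq u x) => [->|ux]; first by rewrite sy exw (negbTE xy).
  by case: (eqVneq u y) => [->|uy] /=; rewrite ?[e w y]sy ?(negbTE eyw) ?andbT ?orbF.
rewrite ?andbF /= ?andbT ?mul0n ?addn0.
case: (eqVneq v y) => [->|vy]; rewrite ?orbF ?addn0 //=.
by case: (eqVneq u w) => [->|uw] /=; rewrite ?(negbTE eyw) ?orbF ?muln0 ?addn0.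
Qed.

Lemma deg_move v : deg (move e x w y) v + (v == x) = deg e v + (v == y).
Proof. have := nbr_move predT v; rewrite !nbrT /=; lia. Qed.

Lemma same_move v :
  same (move e x w y) v + (v == x) * (odd w == odd v) + (v == w) * (odd x == odd v) =
  same e v + (v == y) * (odd w == odd v) + (v == w) * (odd y == odd v).
Proof. exact: nbr_move. Qed.

Lemma cross_move v :
  cross (move e x w y) v + (v == x) * (odd w != odd v) + (v == w) * (odd x != odd v) =
  cross e v + (v == y) * (odd w != odd v) + (v == w) * (odd y != odd v).
Proof.
have h : forall a b : bool, (a == ~~ b) = (a != b) by case; case.
by have := nbr_move (cls (~~ odd v)) v; rewrite /cls !h.
Qed.

Lemma same_move_at :
  [/\ same (move e x w y) x + (odd w == odd x) = same e x,
      same (move e x w y) y = same e y + (odd w == odd y),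
      same (move e x w y) w + (odd x == odd w) = same e w + (odd y == odd w) &
      forall v, v != x -> v != w -> v != y -> same (move e x w y) v = same e v].
Proof.
have [xw xy] := move_neq.
split; [have := same_move x|have := same_move y|have := same_move w|move=> v vx vw vy; have := same_move v];
  by rewrite ?eqxx ?(eq_sym y x) ?(eq_sym w x) ?(eq_sym w y) ?(negbTE xw) ?(negbTE xy) ?(negbTE yw)
     ?(negbTE vx) ?(negbTE vw) ?(negbTE vy) ?mul0n ?addn0 ?mul1n.
Qed.

Lemma cross_move_at :
  [/\ cross (move e x w y) x + (odd w != odd x) = cross e x,
      cross (move e x w y) y = cross e y + (odd w != odd y),
      cross (move e x w y) w + (odd x != odd w) = cross e w + (odd y != odd w) &
      forall v, v != x -> v != w -> v != y -> cross (move e x w y) v = cross e v].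
Proof.
have [xw xy] := move_neq.
split; [have := cross_move x|have := cross_move y|have := cross_move w|move=> v vx vw vy; have := cross_move v];
  by rewrite ?eqxx ?(eq_sym y x) ?(eq_sym w x) ?(eq_sym w y) ?(negbTE xw) ?(negbTE xy) ?(negbTE yw)
     ?(negbTE vx) ?(negbTE vw) ?(negbTE vy) ?mul0n ?addn0 ?mul1n.
Qed.

End Move.

(** The condition [A y -> A x] takes care of an edge between x and y: y may then be an A-neighbour
    of x that is not usable as w, but in that case x is an A-neighbour of y as well. *)
Lemma nbr_pick n (e : rel 'I_n) (A : pred 'I_n) x y :
  simple_graph e -> (A y -> A x) -> nbr e A y < nbr e A x ->
  exists w, [/\ A w, e x w, ~~ e y w & y != w].
Proof.
move=> [sy ir] Ayx lt; case: (pickP [pred w | [&& A w, e x w, ~~ e y w & y != w]]).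
  by move=> w /and4P[]; exists w.
move=> h; exfalso.
have : nbr e A x + A x * e x y <= nbr e A y + A y * e x y.
  have := sum_indic A x (e x y); have := sum_indic A y (e x y).
  rewrite ![_ * e x y]mulnC => <- <-.
  rewrite /nbr -!big_split /=; apply: leq_sum => u Au.
  have := h u; rewrite /= Au /= => hu.
  case: (eqVneq u x) => [->|ux].
    by rewrite (negbTE (ir x)) sy; case: eqVneq => //= _; lia.
  case: (eqVneq u y) hu => [->|uy hu]; first by rewrite (negbTE (ir y)); lia.
  by move: hu; case: (e x u); case: (e y u) => //=; lia.
by case: (A y) (Ayx) => [->//|_]; lia.
Qed.

Lemma same_class_move n (e : rel 'I_n) (x y : 'I_n) :
  simple_graph e -> odd x = odd y -> deg e y + 2 <= deg e x ->
  same e x <= cross e x + ~~ odd x + 1 -> same e y <= cross e y + ~~ odd y + 1 ->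
  (same e x < cross e x + ~~ odd x) || (same e y < cross e y + ~~ odd y) ->
  exists e', [/\ simple_graph e',
    same e' x <= cross e' x + ~~ odd x, same e' y <= cross e' y + ~~ odd y,
    forall v, deg e' v + (v == x) = deg e v + (v == y) &
    forall v, v != x -> v != y -> same e' v = same e v /\ cross e' v = cross e v].
Proof.
move=> se oxy dxy tx ty mxy.
suff [w [exw eyw yw hw]] : exists w, [/\ e x w, ~~ e y w, y != w &
  if odd w == odd x then same e x < cross e x + ~~ odd x + 2 /\ same e y < cross e y + ~~ odd y
  else same e x < cross e x + ~~ odd x /\ same e y < cross e y + ~~ odd y + 2].
  have [xw xy] := move_neq se exw eyw.
  have [sx sy' sw so] := same_move_at se exw eyw yw.
  have [cx cy cw co] := cross_move_at se exw eyw yw.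
  exists (move e x w y); split.
  - exact: move_simple.
  - by move: sx cx tx hw mxy; case: (odd w == odd x) => /=; olia.
  - by move: sy' cy ty hw mxy; rewrite -oxy; case: (odd w == odd x) => /=; olia.
  - exact: deg_move.
  - move=> v vx vy; case: (eqVneq v w) => [->|vw]; last by rewrite so ?co.
    by move: sw cw; rewrite oxy; olia.
move: dxy; rewrite !deg_cls => dxy.
case: (leqP (same e y + cross e x) (cross e y + same e x)) => h.
  have [||w [Aw exw eyw yw]] := @nbr_pick _ e (cls (odd x)) x y se.
  - by rewrite /cls oxy.
  - by rewrite {1}oxy -/(same e x) -/(same e y); move: dxy h; olia.
  exists w; split=> //; rewrite (Aw : odd w == odd x); by move: mxy tx ty h; rewrite oxy; olia.
have [||w [Aw exw eyw yw]] := @nbr_pick _ e (cls (~~ odd x)) x y se.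
- by rewrite /cls oxy; case: (odd y).
- by rewrite {1}oxy -/(cross e x) -/(cross e y); move: dxy h; olia.
exists w; split=> //; move: Aw; rewrite /cls => /eqP ->.
by move: mxy tx ty h; rewrite oxy; case: (odd y) => /=; olia.
Qed.


(** * Passing an excess along paired columns B and C through rows R *)

Section Chain.
Variables (n : nat) (R B C : pred 'I_n) (sg : 'I_n -> 'I_n).
Hypothesis (sgC : forall b, B b -> C (sg b)).
Hypothesis sumC : forall f : 'I_n -> nat, \sum_(u | C u) f u = \sum_(u | B u) f (sg u).
Hypothesis RB : forall u, R u -> ~~ B u.
Hypothesis RC : forall u, R u -> ~~ C u.
Hypothesis BC : forall u, B u -> ~~ C u.

Let gap (e : rel 'I_n) := [set p : 'I_n * 'I_n | [&& R p.1, B p.2, e p.1 p.2 & ~~ e p.1 (sg p.2)]].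

(* The excess at t is handed from column to column of B through rows where B and
   C balance, until a row with more B- than C-neighbours lets it cross to C;
   every handover removes a pair from gap. *)
Lemma chain m (e : rel 'I_n) (t : 'I_n) :
  #|gap e| <= m -> simple_graph e -> B t ->
  (forall b, B b -> nbr e R (sg b) <= nbr e R b) -> nbr e R (sg t) < nbr e R t ->
  exists e' z b, [/\ simple_graph e', R z, B b, nbr e C z < nbr e B z &
    forall A : pred 'I_n, (forall b b', B b -> B b' -> A b = A b') ->
      (forall z z', R z -> R z' -> A z = A z') ->
    forall v, nbr e' A v + (v == t) * A z + (v == z) * A t =
              nbr e A v + (v == sg b) * A z + (v == z) * A (sg b)].
Proof.
elim: m e t => [|m IH] e t gm se Bt le lt.
all: have Rt : ~~ R (sg t) by apply: contraL (sgC Bt) => /RC.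
all: have [|z [Rz tz sz nz]] := @nbr_pick _ e R t (sg t) se _ lt; first by rewrite (negbTE Rt).
all: have [sy ir] := se.
  exfalso; move: gm; rewrite leqn0 cards_eq0 => /eqP/setP/(_ (z, t)).
  by rewrite !inE /= Rz Bt sy tz sy sz.
case: (ltnP (nbr e C z) (nbr e B z)) => [ltz|lez].
  exists (move e t z (sg t)), z, t; split=> //; first exact: move_simple.
  by move=> A _ _ v; rewrite nbr_move.
(* The row z has no surplus in B, yet the pair of t counts for B only; so some other pair counts for
   C only. *)
have [b' [Bb' zsb' zb']] : exists b', [/\ B b', e z (sg b') & ~~ e z b'].
  case: (pickP [pred b | [&& B b, e z (sg b) & ~~ e z b]]) => [b /and3P[]|no]; first by exists b.
  exfalso; move: lez; rewrite leqNgt => /negP; apply.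
  rewrite /nbr sumC (bigD1 t) //= [X in _ < X](bigD1 t) //= [e z t]sy tz [e z (sg t)]sy (negbTE sz).
  rewrite add0n add1n ltnS; apply: leq_sum => b /andP[Bb _].
  by have := no b; rewrite /= Bb; case: (e z b); case: (e z (sg b)).
have tb' : t != b' by apply: contraNneq zb' => <-; rewrite sy.
have b'z : b' != z by apply: contraTneq Rz => <-; apply: contraL Bb' => /RB.
have bz' : ~~ e b' z by rewrite sy.
set e1 := move e t z b'.
have se1 : simple_graph e1 by apply: move_simple.
have mv A v := nbr_move se tz bz' b'z A v; rewrite -/e1 in mv.
have zB u : B u -> (u == z) = false by move=> Bu; apply/negbTE; apply: contraTneq Bu => ->; apply: RB.
have zC u : C u -> (u == z) = false by move=> Bu; apply/negbTE; apply: contraTneq Bu => ->; apply: RC.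
have Cn u b : C u -> B b -> (u == b) = false.
  by move=> Cu Bb; apply/negbTE; apply: contraTneq Cu => ->; apply: BC.
have e1C b : B b -> nbr e1 R (sg b) = nbr e R (sg b).
  move=> Bb; have Cb := sgC Bb.
  by have := mv R (sg b); rewrite (Cn _ t) // (Cn _ b') // zC // !mul0n !addn0.
have e1B b : B b -> nbr e1 R b + (b == t) = nbr e R b + (b == b').
  by move=> Bb; have := mv R b; rewrite zB // !mul0n !addn0 Rz !muln1.
have [|||e' [z' [b [se' Rz' Bb ltz' upd]]]] := IH e1 b' _ se1 Bb'.
- rewrite -ltnS; apply: leq_trans gm; apply: proper_card.
  apply/properP; split; last first.
    exists (z, t); first by rewrite !inE /= Rz Bt ![e z _]sy tz sz.
    rewrite !inE /= /e1 /move !eqxx (negbTE tb') (zB t Bt) /=.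
    by rewrite ?andbF ?orbT ?andbF.
  apply/subsetP => -[r b]; rewrite !inE /= => /and4P[Rr Bb].
  rewrite Rr Bb /= /e1 /move.
  have rt : (r == t) = false by apply/negbTE; apply: contraTneq Bt => <-; apply: RB.
  have rb : (r == b') = false by apply/negbTE; apply: contraTneq Bb' => <-; apply: RB.
  rewrite rt rb /= (Cn (sg b) t) ?sgC // (Cn (sg b) b') ?sgC // !andbF !orbF !andbT.
  case/orP => [/andP[-> _] ->//|/andP[/eqP-> /eqP->]].
  by rewrite zsb'.
(* Column t can afford the loss because its inequality was strict. *)
- move=> b Bb; rewrite e1C //; have := e1B b Bb; have := le b Bb; case: eqVneq => [->|_] /=.
    by move: lt; rewrite (negbTE tb'); olia.
  by olia.
- rewrite e1C //; have := e1B b' Bb'; rewrite eqxx eq_sym (negbTE tb'); have := le b' Bb'; olia.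
have nz' u : B u -> (z' == u) = false by move=> Bu; apply/negbTE; apply: contraTneq Bu => <-; apply: RB.
exists e', z', b; split=> //.
  have := mv B z'; have := mv C z'; rewrite (nz' t) // (nz' b') // !mul0n !addn0.
  by rewrite Bt Bb' (negbTE (BC Bt)) (negbTE (BC Bb')) !muln0 !addn0; move: ltz'; clear; lia.
(* The updates telescope: [A t = A b'] hides the handover from the row z, and [A z' = A z] cancels
   it at the column b'. *)
move=> A AB AR v; have := upd A AB AR v; have := mv A v.
rewrite (AR z' z) // (AB t b') //; clear.
by do 4!case: eqP => _; rewrite ?mul0n ?mul1n; lia.
Qed.

End Chain.

(** * Complements *)

Definition compl n (e : rel 'I_n) : rel 'I_n := fun u v => (u != v) && ~~ e u v.

Lemma compl_simple n (e : rel 'I_n) : simple_graph e -> simple_graph (compl e).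
Proof. by case=> sy ir; split=> [u v|v]; rewrite /compl ?eqxx // eq_sym sy. Qed.

Lemma nbr_compl n (e : rel 'I_n) A v : simple_graph e ->
  nbr (compl e) A v + nbr e A v + A v = \sum_(u | A u) 1.
Proof.
case=> sy ir; have := sum_indic A v 1; rewrite mul1n => <-.
rewrite /nbr -!big_split; apply: eq_bigr => u _ /=; rewrite /compl.
by case: (eqVneq v u) => [->|_] /=; rewrite ?(negbTE (ir u)) ?addn0 //; case: (e v u).
Qed.


(** * Alternating sums over the two parity classes *)

(** Dropping the first term swaps the two classes, so the two bounds trade places in the
    induction. *)
Lemma parity_sum_nat (f : nat -> nat) m k :
  (forall j, m <= j -> j.+1 < m + k -> f j.+1 <= f j) ->
  \sum_(m <= j < m + k | odd j != odd m) f j <= \sum_(m <= j < m + k | odd j == odd m) f j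
  <= \sum_(m <= j < m + k | odd j != odd m) f j + f m.
Proof.
elim: k m => [|k IH] m mono; first by rewrite addn0 !big_geq.
have lt : m < m + k.+1 by rewrite -addSnnS leq_addr.
rewrite ![\sum_(m <= _ < _ | _) _]big_ltn_cond // eqxx /=.
rewrite -addSnnS.
have e1 : \sum_(m.+1 <= j < m.+1 + k | odd j == odd m) f j = \sum_(m.+1 <= j < m.+1 + k | odd j != odd m.+1) f j.
  by apply: eq_bigl => j /=; case: (odd j); case: (odd m).
have e2 : \sum_(m.+1 <= j < m.+1 + k | odd j != odd m) f j = \sum_(m.+1 <= j < m.+1 + k | odd j == odd m.+1) f j.
  by apply: eq_bigl => j /=; case: (odd j); case: (odd m).
rewrite e1 e2 {e1 e2 lt}; case: k IH mono => [|k] IH mono; first by rewrite addn0 !big_geq // addn0 /=.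
have /andP[] := IH m.+1 (fun j mj jk => mono j (ltnW mj) (leq_trans jk (eq_leq (addSnnS _ _)))).
have := mono m (leqnn _).
rewrite addnS ltnS addnS ltnS leq_addr => /(_ isT).
by clear; lia.
Qed.

Lemma parity_sum n (F : 'I_n.+1 -> nat) (m : 'I_n.+1) :
  (forall u v : 'I_n.+1, m <= u -> u <= v -> F v <= F u) ->
  \sum_(u : 'I_n.+1 | (odd u != odd m) && (m <= u)) F u <=
  \sum_(u : 'I_n.+1 | (odd u == odd m) && (m <= u)) F u <=
  \sum_(u : 'I_n.+1 | (odd u != odd m) && (m <= u)) F u + F m.
Proof.
move=> mono.
have conv (P : pred nat) : \sum_(u : 'I_n.+1 | P u && (m <= u)) F u =
    \sum_(m <= j < m + (n.+1 - m) | P j) F (inord j).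
  rewrite subnKC ?(ltnW (ltn_ord m)) // big_geq_mkord.
  by apply: eq_bigr => u _; rewrite inord_val.
rewrite (conv (fun j => odd j != odd m)) (conv (fun j => odd j == odd m)).
have := @parity_sum_nat (fun j => F (inord j)) m (n.+1 - m).
rewrite inord_val; apply.
move=> j mj jn; have jn' : j.+1 < n.+1 by rewrite subnKC ?(ltnW (ltn_ord m)) in jn.
by apply: mono; rewrite ?inordK // ltnW.
Qed.

(** The constant sequence 1 is nonincreasing, so the two counts differ by 0 or 1, and the parity of
    their total decides which. *)
Lemma parity_count n (i : 'I_n.+1) :
  \sum_(u : 'I_n.+1 | (odd u == odd i) && (i <= u)) 1 =
  \sum_(u : 'I_n.+1 | (odd u != odd i) && (i <= u)) 1 + (odd n == odd i).
Proof.
have /andP[] := @parity_sum _ (fun=> 1) i (fun _ _ _ _ => leqnn _).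
set q := \sum_(u < _ | (odd u != _) && _) 1; set p := \sum_(u < _ | _) 1 => h1 h2.
have : p + q = n.+1 - i.
  transitivity (\sum_(i <= j < n.+1 | true) 1); last by rewrite sum_nat_const_nat muln1.
  rewrite (big_geq_mkord i n.+1 (fun=> true)) /=.
  rewrite [RHS](bigID (fun u : 'I_n.+1 => odd u == odd i)) /=.
  by congr (_ + _); apply: eq_bigl => u; rewrite andbC.
move=> /(congr1 odd); rewrite oddD oddB ?(ltnW (ltn_ord i)) //=.
have [->|->] : p = q \/ p = q + 1 by move: h1 h2; clear; lia.
  by rewrite addbb; case: (odd n); case: (odd i) => //=; rewrite addn0.
by rewrite oddD /=; case: (odd q); case: (odd n); case: (odd i) => //=; rewrite addn0.
Qed.

Lemma parity_count_below n (i : 'I_n.+1) :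
  \sum_(u : 'I_n.+1 | (odd u != odd i) && (u < i)) 1 + ~~ odd i =
  \sum_(u : 'I_n.+1 | (odd u == odd i) && (u < i)) 1 + 1.
Proof.
have conv (P : pred nat) : \sum_(u : 'I_n.+1 | P u && (u < i)) 1 = \sum_(0 <= j < 0 + i | P j) 1.
  by rewrite add0n (big_nat_widen 0 i n.+1) ?(ltnW (ltn_ord i)) // big_mkord.
have /andP[] := @parity_sum_nat (fun=> 1) 0 i (fun _ _ _ => leqnn _).
rewrite (conv (fun j => odd j != odd i)) (conv (fun j => odd j == odd i)) /=.
have : \sum_(0 <= j < 0 + i | odd j == false) 1 + \sum_(0 <= j < 0 + i | odd j != false) 1 = i.
  transitivity (\sum_(0 <= j < 0 + i | true) 1); last by rewrite sum_nat_const_nat muln1 subn0.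
  by rewrite [RHS](bigID (fun j => odd j == false)).
have e1 b : \sum_(0 <= j < 0 + i | odd j != b) 1 = \sum_(0 <= j < 0 + i | odd j == ~~ b) 1.
  by apply: eq_bigl => j; case: (odd j); case: b.
rewrite !e1 /=; set p := \sum_(_ <= _ < _ | _ == true) _; set q := \sum_(_ <= _ < _ | _ == false) _.
move=> /(congr1 odd); rewrite oddD => h h1 h2.
have [E|E] : q = p \/ q = p + 1 by move: h1 h2; clear; lia.
  by move: h; rewrite E addbb => <- /=; rewrite -/p -/q E.
by move: h; rewrite E oddD addbAC addbb /= => <- /=; rewrite -/p -/q E; clear; lia.
Qed.

Lemma parity_shift n (i : 'I_n.+1) (f : 'I_n.+1 -> nat) : odd n != odd i ->
  \sum_(u : 'I_n.+1 | (odd u != odd i) && (i <= u)) f u =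
  \sum_(u : 'I_n.+1 | (odd u == odd i) && (i <= u)) f (inord u.+1).
Proof.
move=> ni; rewrite (reindex_onto (fun u : 'I_n.+1 => inord u.+1) (fun u => inord u.-1)) /=.
  apply: eq_bigl => u.
  case: (ltnP u n) => [un|nu].
    rewrite inordK // inord_val eqxx andbT /=.
    case: (leqP i u) => [iu|ui]; first by rewrite leqW // !andbT; case: (odd u); case: (odd i).
    rewrite andbF leq_eqVlt ltnS leqNgt ui orbF.
    by case: (eqVneq (i : nat) u.+1) => [->|_]; rewrite ?andbF //= eqxx.
  have -> : (u : nat) = n by apply/eqP; rewrite eqn_leq nu -ltnS ltn_ord.
  (* The index n has no successor and [inord] defaults to [ord0], which fails the filter by parity
     if i = 0 and by size if i > 0. *)
  have -> : (inord n.+1 : 'I_n.+1) = ord0 by apply: val_inj; rewrite /= /inord val_insubd ltnn.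
  rewrite (negbTE ni) /= leqn0.
  by case: (eqVneq (i : nat) 0) => [->|_]; rewrite ?andbF.
move=> u /andP[ou iu].
have u0 : 0 < u.
  rewrite lt0n; apply: contraNneq ou => u0.
  by move: iu; rewrite u0 leqn0 => /eqP ->.
rewrite inordK; last by apply: leq_ltn_trans (ltn_ord u); rewrite leq_pred.
by rewrite prednK // inord_val.
Qed.


(** * Splitting sums and double counting *)

Lemma sum_const_cond n (A : pred 'I_n) k : \sum_(u | A u) k = (\sum_(u | A u) 1) * k.
Proof. by rewrite big_distrl /=; apply: eq_bigr => u _; rewrite mul1n. Qed.

Lemma sum_if_split n (P Q : pred 'I_n) (f : 'I_n -> nat) :
  \sum_(u | Q u) f u = \sum_(u | P u && Q u) f u + \sum_(u | ~~ P u && Q u) f u.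
Proof. by rewrite (bigID P); congr (_ + _); apply: eq_bigl => u; rewrite andbC. Qed.

Lemma nbr_split n (e : rel 'I_n) (P Q : pred 'I_n) v :
  nbr e P v = nbr e (fun u => P u && Q u) v + nbr e (fun u => P u && ~~ Q u) v.
Proof. by rewrite /nbr (bigID Q). Qed.

Lemma nbr_exchange n (e : rel 'I_n) (A B : pred 'I_n) : simple_graph e ->
  \sum_(u | A u) nbr e B u = \sum_(u | B u) nbr e A u.
Proof.
by case=> sy _; rewrite /nbr exchange_big; apply: eq_bigr => u _; apply: eq_bigr => v _; rewrite sy.
Qed.

Lemma nbr_gt0 n (e : rel 'I_n) (A : pred 'I_n) v : 0 < nbr e A v -> exists2 u, A u & e v u.
Proof.
case: (pickP [pred u | A u && e v u]) => [u /andP[]|no]; first by exists u.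
rewrite /nbr big1 // => u Au; by have := no u; rewrite /= Au => /= ->.
Qed.

Lemma nbr_gt0P n (e : rel 'I_n) (A : pred 'I_n) v u : A u -> e v u -> 0 < nbr e A v.
Proof. by move=> Au vu; rewrite /nbr (bigD1 u) //= vu. Qed.

Definition transfer n (e : rel 'I_n) x y := exists e', [/\ simple_graph e', balanced e' &
  forall v, deg e' v + (v == x) = deg e v + (v == y)].

(** * Moving one unit of degree from vertex i to the last vertex *)

Section Core.
Variables (n : nat) (e : rel 'I_n.+1) (i : 'I_n.+1).
Notation l := (@ord_max n).
(** The graph e realizes a sequence with one unit added at i and one removed at n; this is the
    source of the strict inequalities at i and n and of the degree gap 2. *)
Hypotheses (se : simple_graph e) (bal : balanced e) (il : i < n).
Hypothesis mono : forall u v : 'I_n.+1, u <= v -> deg e v <= deg e u.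
Hypothesis deg_i : forall w : 'I_n.+1, i < w -> deg e w < deg e i.
Hypothesis deg_l : forall w : 'I_n.+1, i <= w -> w < n -> deg e l < deg e w.
Hypothesis deg_il : deg e l + 2 <= deg e i.
Hypothesis small : forall u : 'I_n.+1, u < i -> deg e u < n.
Hypothesis full : forall x b h : 'I_n.+1, i <= b -> h < i -> x != h -> e x b -> e x h.

Definition clsP : pred 'I_n.+1 := fun u => odd u == odd i.
Definition clsQ : pred 'I_n.+1 := fun u => odd u != odd i.
Definition tailP : pred 'I_n.+1 := fun u => (odd u == odd i) && (i <= u).
Definition tailQ : pred 'I_n.+1 := fun u => (odd u != odd i) && (i <= u).
Definition headP : pred 'I_n.+1 := fun u => (odd u == odd i) && (u < i).
Definition headQ : pred 'I_n.+1 := fun u => (odd u != odd i) && (u < i).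

Notation cP := (nbr e clsP).
Notation cQ := (nbr e clsQ).
Notation tP := (nbr e tailP).
Notation tQ := (nbr e tailQ).

Lemma nbr_clsP e1 v : nbr e1 clsP v = nbr e1 headP v + nbr e1 tailP v.
Proof.
rewrite (nbr_split _ _ (fun u : 'I_n.+1 => u < i)); congr (_ + _).
by apply: eq_bigl => u; rewrite /tailP -leqNgt.
Qed.

Lemma nbr_clsQ e1 v : nbr e1 clsQ v = nbr e1 headQ v + nbr e1 tailQ v.
Proof.
rewrite (nbr_split _ _ (fun u : 'I_n.+1 => u < i)); congr (_ + _).
by apply: eq_bigl => u; rewrite /tailQ -leqNgt.
Qed.

Lemma same_P e1 v : clsP v -> same e1 v = nbr e1 clsP v.
Proof. by rewrite /same /cls /clsP => /eqP ->. Qed.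

Lemma cross_P e1 v : clsP v -> cross e1 v = nbr e1 clsQ v.
Proof.
rewrite /cross /cls /clsP => /eqP ->.
by apply: eq_bigl => u; rewrite /clsQ; case: (odd u); case: (odd i).
Qed.

Lemma same_Q e1 v : clsQ v -> same e1 v = nbr e1 clsQ v.
Proof.
rewrite /same /cls /clsQ => h; apply: eq_bigl => u; rewrite /clsQ.
by move: h; case: (odd u); case: (odd v); case: (odd i).
Qed.

Lemma cross_Q e1 v : clsQ v -> cross e1 v = nbr e1 clsP v.
Proof.
rewrite /cross /cls /clsQ => h; apply: eq_bigl => u; rewrite /clsP.
by move: h; case: (odd u); case: (odd v); case: (odd i).
Qed.

Lemma deg_PQ e1 v : deg e1 v = nbr e1 clsP v + nbr e1 clsQ v.
Proof. by rewrite -nbrT (nbr_split _ _ clsP). Qed.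

Lemma clsQE v : clsQ v = ~~ clsP v. Proof. by []. Qed.

Lemma balancedE e1 : balanced e1 <->
  (forall v, clsP v -> nbr e1 clsP v <= nbr e1 clsQ v + ~~ odd i) /\
  (forall v, clsQ v -> nbr e1 clsQ v <= nbr e1 clsP v + odd i).
Proof.
split=> [b1|[h1 h2] v].
  split=> v h; have := b1 v.
    by rewrite same_P // cross_P // (eqP h).
  rewrite same_Q // cross_Q //; move: h; rewrite /clsQ.
  by case: (odd v); case: (odd i).
case: (boolP (clsP v)) => h.
  by have := h1 v h; rewrite same_P // cross_P // (eqP h).
have := h2 v h; rewrite same_Q // cross_Q //; move: h; rewrite /clsP.
by case: (odd v); case: (odd i).
Qed.

Lemma bal_P v : clsP v -> cP v <= cQ v + ~~ odd i.
Proof. by have /balancedE[h _] := bal; apply: h. Qed.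

Lemma bal_Q v : clsQ v -> cQ v <= cP v + odd i.
Proof. by have /balancedE[_ h] := bal; apply: h. Qed.

Lemma head_full (v u : 'I_n.+1) : 0 < tP v + tQ v -> u < i -> e v u = (u != v).
Proof.
have [sy ir] := se => h ui; case: (eqVneq u v) => [->|uv]; first exact: negbTE.
suff [b ib vb] : exists2 b : 'I_n.+1, i <= b & e v b by apply: full ib ui _ vb; rewrite eq_sym.
case: (posnP (tP v)) => [h0|]; last by case/nbr_gt0 => b /andP[_ ib]; exists b.
by move: h; rewrite h0 => /nbr_gt0[b /andP[_ ib]]; exists b.
Qed.

Lemma head_count (A : pred 'I_n.+1) (v : 'I_n.+1) : 0 < tP v + tQ v ->
  nbr e (fun u => A u && (u < i)) v + A v && (v < i) = \sum_(u | A u && (u < i)) 1.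
Proof.
move=> h; rewrite -(mul1n (nat_of_bool (_ && _))).
rewrite -(sum_indic (fun u => A u && (u < i)) v 1) -big_split /=.
by apply: eq_bigr => u /andP[_ ui]; rewrite head_full //; case: eqVneq.
Qed.

(** Such a v sees the whole head except itself. By [parity_count_below] the head and the allowance
    together contribute 1 to the slack in the class of i and, in [slack_Q], 0 in the other class,
    whatever the parity of i. *)
Lemma slack_P (v : 'I_n.+1) : clsP v -> 0 < tP v + tQ v ->
  cQ v + ~~ odd i + tP v = cP v + 1 + (v < i) + tQ v.
Proof.
move=> Pv h; have hP : nbr e headP v + (clsP v && (v < i)) = _ := head_count clsP h.
have hQ : nbr e headQ v + (clsQ v && (v < i)) = _ := head_count clsQ h.
move: (parity_count_below i) hP hQ; rewrite clsQE Pv /= nbr_clsP nbr_clsQ => E hP hQ.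
by move: E; rewrite -[X in X + _ = _]hQ -[X in _ = X + 1]hP; olia.
Qed.

Lemma slack_Q (v : 'I_n.+1) : clsQ v -> 0 < tP v + tQ v ->
  cP v + odd i + tQ v = cQ v + (v < i) + tP v.
Proof.
move=> Qv h; have hP : nbr e headP v + (clsP v && (v < i)) = _ := head_count clsP h.
have hQ : nbr e headQ v + (clsQ v && (v < i)) = _ := head_count clsQ h.
move: (parity_count_below i) hP hQ; rewrite -[clsP v]negbK -clsQE Qv /= nbr_clsP nbr_clsQ => E hP hQ.
move: E; rewrite -[X in X + _ = _]hQ -[X in _ = X + 1]hP.
by case: (odd i) => /=; olia.
Qed.

Notation hd := (nbr e (fun u : 'I_n.+1 => u < i)).

Lemma deg_head_tail (v : 'I_n.+1) : deg e v = hd v + (tP v + tQ v).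
Proof.
rewrite -nbrT (nbr_split _ _ (fun u : 'I_n.+1 => u < i)) /=; congr (_ + _).
rewrite (nbr_split _ _ clsP); congr (_ + _);
  by apply: eq_bigl => u; rewrite -leqNgt andbC.
Qed.

Lemma sum_below : \sum_(u : 'I_n.+1 | u < i) 1 = i.
Proof.
transitivity (\sum_(0 <= j < i) 1); last by rewrite sum_nat_const_nat muln1 subn0.
by rewrite (big_nat_widen 0 i n.+1) ?(ltnW (ltn_ord i)) // big_mkord.
Qed.

Lemma head_le (v : 'I_n.+1) : hd v + (v < i) <= i.
Proof.
have [sy ir] := se.
rewrite -[X in _ <= X]sum_below -(mul1n (nat_of_bool _)).
rewrite -(sum_indic (fun u : 'I_n.+1 => u < i) v 1) -big_split /=.
by apply: leq_sum => u _; case: (eqVneq u v) => [->|_]; rewrite ?(negbTE (ir v)); case: (e v u).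
Qed.

Lemma head_eq (v : 'I_n.+1) : 0 < tP v + tQ v -> hd v + (v < i) = i.
Proof.
move=> h; rewrite -[RHS]sum_below -(mul1n (nat_of_bool _)).
rewrite -(sum_indic (fun u : 'I_n.+1 => u < i) v 1) -big_split /=.
by apply: eq_bigr => u ui; rewrite head_full //; case: eqVneq.
Qed.

(** If v has a tail neighbour, it fills the head, so u has no more head neighbours than v and its
    larger degree must show in the tail. *)
Lemma tail_mono (u v : 'I_n.+1) : u <= v -> tP v + tQ v <= tP u + tQ u.
Proof.
move=> uv; case: (posnP (tP v + tQ v)) => [->//|h].
have vu : (v < i) <= (u < i) by case: ltnP => // vi; rewrite (leq_ltn_trans uv).
have := mono uv; rewrite !deg_head_tail; have := head_eq h; have := head_le u.
by move: vu; clear; lia.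
Qed.

(** A tail vertex has n - i possible tail neighbours. A head vertex has n - i + 1, but it already
    has i - 1 neighbours in the head and is not dominating. *)
Lemma tail_lt (v : 'I_n.+1) : tP v + tQ v + i <= n.
Proof.
case: (posnP (tP v + tQ v)) => [->|h]; first by rewrite add0n ltnW.
case: (ltnP v i) => vi.
  by have := small vi; rewrite deg_head_tail; have := head_eq h; rewrite vi; clear; lia.
have -> : tP v + tQ v = nbr e (fun u : 'I_n.+1 => i <= u) v.
  rewrite [RHS](nbr_split _ _ clsP); congr (_ + _); by apply: eq_bigl => u; rewrite andbC.
have [sy ir] := se.
have : nbr e (fun u : 'I_n.+1 => i <= u) v + 1 * (i <= v) <= \sum_(u : 'I_n.+1 | i <= u) 1.
  rewrite -(sum_indic (fun u : 'I_n.+1 => i <= u) v 1) -big_split /=.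
  by apply: leq_sum => u _; case: (eqVneq u v) => [->|_]; rewrite ?(negbTE (ir v)); case: (e v u).
have : \sum_(u : 'I_n.+1 | i <= u) 1 + i = n.+1.
  transitivity (\sum_(u : 'I_n.+1 | i <= u) 1 + \sum_(u : 'I_n.+1 | u < i) 1); first by rewrite sum_below.
  transitivity (\sum_(u : 'I_n.+1) 1); last by rewrite sum1_card card_ord.
  rewrite [RHS](bigID (fun u : 'I_n.+1 => i <= u)) /=; congr (_ + _).
  by apply: eq_bigl => u; rewrite ltnNge.
by rewrite vi; clear; lia.
Qed.

Notation SP := (\sum_(u : 'I_n.+1 | i <= u) cP u).
Notation SQ := (\sum_(u : 'I_n.+1 | i <= u) cQ u).

(* Counted from the other end, SP and SQ are the sums of the nonincreasing tail
   degrees over the two parity classes. *)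
Lemma tail_sum_rel :
  if odd i then SP <= SQ <= SP + (n - i) else SQ <= SP <= SQ + (n - i).
Proof.
have z0 : tP ord0 + tQ ord0 <= n - i by have := tail_lt ord0; clear; lia.
have E (A : pred 'I_n.+1) : \sum_(u : 'I_n.+1 | i <= u) nbr e A u = \sum_(u | A u) (tP u + tQ u).
  rewrite nbr_exchange //; apply: eq_bigr => u _.
  rewrite (nbr_split _ _ clsP); congr (_ + _); by apply: eq_bigl => w; rewrite andbC.
have := @parity_sum _ (fun v => tP v + tQ v) ord0 (fun u v _ uv => tail_mono uv).
have e0 : \sum_(u : 'I_n.+1 | (odd u == odd (@ord0 n)) && (@ord0 n <= u)) (tP u + tQ u) =
          \sum_(u : 'I_n.+1 | ~~ odd u) (tP u + tQ u).
  by apply: eq_bigl => u /=; case: (odd u).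
have e1 : \sum_(u : 'I_n.+1 | (odd u != odd (@ord0 n)) && (@ord0 n <= u)) (tP u + tQ u) =
          \sum_(u : 'I_n.+1 | odd u) (tP u + tQ u).
  by apply: eq_bigl => u /=; case: (odd u).
rewrite e0 e1 => /andP[h1 h2]; rewrite !E.
case: (boolP (odd i)) => oi.
  have eP : clsP =1 (fun u => odd u) by move=> u; rewrite /clsP oi; case: (odd u).
  have eQ : clsQ =1 (fun u => ~~ odd u) by move=> u; rewrite /clsQ oi; case: (odd u).
  rewrite (eq_bigl _ _ eP) (eq_bigl _ _ eQ) h1 /=.
  by apply: leq_trans h2 _; rewrite leq_add2l.
have eP : clsP =1 (fun u => ~~ odd u) by move=> u; rewrite /clsP (negbTE oi); case: (odd u).
have eQ : clsQ =1 (fun u => odd u) by move=> u; rewrite /clsQ (negbTE oi); case: (odd u).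
rewrite (eq_bigl _ _ eP) (eq_bigl _ _ eQ) h1 /=.
by apply: leq_trans h2 _; rewrite leq_add2l.
Qed.

Notation kP := (\sum_(u | tailP u) 1).
Notation kQ := (\sum_(u | tailQ u) 1).

Lemma tail_split (f : 'I_n.+1 -> nat) :
  \sum_(u : 'I_n.+1 | i <= u) f u = \sum_(u | tailP u) f u + \sum_(u | tailQ u) f u.
Proof. exact: (sum_if_split clsP). Qed.

Lemma tail_count : kP + kQ + i = n.+1.
Proof.
rewrite -tail_split -{2}sum_below.
transitivity (\sum_(u : 'I_n.+1) 1); last by rewrite sum1_card card_ord.
by rewrite [RHS](bigID (fun u : 'I_n.+1 => i <= u)) /=; congr (_ + _); apply: eq_bigl => u; rewrite ltnNge.
Qed.

Lemma tailP_i : tailP i. Proof. by rewrite /tailP eqxx leqnn. Qed.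

Lemma tailP_deg b : tailP b -> b != i -> deg e b < deg e i.
Proof. by case/andP=> _ ib bi; apply: deg_i; rewrite ltn_neqAle ib andbT eq_sym. Qed.

Lemma tail_deg_l (a : 'I_n.+1) : i <= a -> a != l -> deg e l < deg e a.
Proof.
move=> ia al; apply: deg_l => //; rewrite ltn_neqAle -ltnS ltn_ord andbT.
by apply: contraNneq al => h; apply/eqP/val_inj.
Qed.

Lemma il_neq : i != l.
Proof. by apply: contraTneq il => ->; rewrite ltnn. Qed.

Hypothesis stuck : ~ transfer e i l.

(** * The case where i and n have the same parity *)

Section SameClass.
Hypothesis li : odd n = odd i.

Let oil : odd i = odd l. Proof. by rewrite /= li. Qed.

Let Pl : clsP l. Proof. by rewrite /clsP /= li. Qed.

Lemma tight_il : cP i = cQ i + ~~ odd i /\ cP l = cQ l + ~~ odd i.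
Proof.
have Pi : clsP i by case/andP: tailP_i.
have bi := bal_P Pi; have bl := bal_P Pl.
suff : ~~ ((same e i < cross e i + ~~ odd i) || (same e l < cross e l + ~~ odd l)).
  rewrite !same_P // !cross_P // -oil negb_or -!leqNgt => /andP[h1 h2].
  by split; apply/eqP; rewrite eqn_leq ?bi ?bl.
apply/negP => h; apply: stuck.
have [||e' [se' si sl dg ot]] := same_class_move se oil deg_il _ _ h.
- exact: leq_trans (bal i) (leq_addr _ _).
- exact: leq_trans (bal l) (leq_addr _ _).
exists e'; split=> // v; case: (eqVneq v i) => [->//|vi]; case: (eqVneq v l) => [->//|vl].
by have [-> ->] := ot v vi vl; apply: bal.
Qed.

(** With slack 2 or more, t could relay the unit: it takes a neighbour in its own class from i and
    gives one across to n, which costs it 2, while i and n gain slack. *)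
Lemma tailP_not_rich t : tailP t -> cQ t + ~~ odd i <= cP t + 1.
Proof.
move=> Tt; rewrite leqNgt; apply/negP => rich.
have [ti tl] := tight_il; have /andP[Pt it] := Tt; rewrite -/(clsP t) in Pt.
have Pi : clsP i by case/andP: tailP_i.
have nti : t != i by apply: contraTneq rich => ->; rewrite ti; olia.
have ntl : t != l by apply: contraTneq rich => ->; rewrite tl; olia.
have := tailP_deg Tt nti; have := tail_deg_l it ntl; rewrite !deg_PQ => dl di.
have [//||u [Au iu tu nu]] := @nbr_pick _ e clsP i t se; first by move: di rich ti; olia.
set e1 := move e i u t; have se1 : simple_graph e1 by apply: move_simple.
have m1 A v := nbr_move se iu tu nu A v; rewrite -/e1 in m1.
have e1P v : nbr e1 clsP v + (v == i) = cP v + (v == t).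
  by have := m1 clsP v; rewrite Au Pi Pt !muln1; olia.
have e1Q v : nbr e1 clsQ v = cQ v.
  by have := m1 clsQ v; rewrite !clsQE Au Pi Pt !muln0 !addn0.
have [||z [Az tz lz nz]] := @nbr_pick _ e1 clsQ t l se1; first by rewrite !clsQE Pt Pl.
  by rewrite !e1Q; move: dl rich tl; olia.
set e2 := move e1 t z l; have se2 : simple_graph e2 by apply: move_simple.
have m2 A v := nbr_move se1 tz lz nz A v; rewrite -/e2 in m2.
have e2P v : nbr e2 clsP v + (v == i) = cP v + (v == t).
  have := m2 clsP v; rewrite -e1P -[clsP z]negbK -clsQE Az Pt Pl !muln0 !muln1 /=; olia.
have e2Q v : nbr e2 clsQ v + (v == t) = cQ v + (v == l).
  by have := m2 clsQ v; rewrite e1Q Az !clsQE Pt Pl !muln0 !muln1 !addn0.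
apply: stuck; exists e2; split=> //.
  apply/balancedE; split=> v Cv.
    have := e2P v; have := e2Q v; have := bal_P Cv; move: rich.
    case: (eqVneq v t) => [->|_]; last by olia.
    by rewrite (negbTE nti) (negbTE ntl); olia.
  have := e2P v; have := e2Q v; have := bal_Q Cv.
  have ne w : clsP w -> (v == w) = false.
    by move=> Pw; apply/negbTE; apply: contraTneq Cv => ->; rewrite clsQE Pw.
  by rewrite !ne //; olia.
by move=> v; rewrite !deg_PQ; have := e2P v; have := e2Q v; olia.
Qed.

(** Otherwise w relays the unit: u, in the class of i, passes from i to w, and y, in the class of w,
    from w to n. All five vertices gain slack; the lack of slack at w, with i and n tight, is what
    makes u and y exist by degrees. *)
Lemma tailQ_rich w : tailQ w -> cQ w + 2 <= cP w + odd i.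
Proof.
move=> Tw; rewrite leqNgt addn2 ltnS; apply/negP => poor.
have [ti tl] := tight_il; have /andP[Qw iw] := Tw; rewrite -/(clsQ w) in Qw.
have Pi : clsP i by case/andP: tailP_i.
have nPQ u v : clsP u -> clsQ v -> (u == v) = false.
  by move=> Pu Qv; apply/negbTE; apply: contraTneq Qv => <-; rewrite clsQE Pu.
have wi : i < w by rewrite ltn_neqAle iw andbT; have := nPQ i w Pi Qw => /negbT.
have wl : w != l by rewrite eq_sym nPQ.
have := deg_i wi; have := tail_deg_l iw wl; rewrite !deg_PQ => dl di.
have [||u [Au iu wu nu]] := @nbr_pick _ e clsP i w se; first by rewrite Pi.
  by move: di poor ti; olia.
have [||y [Ay wy ly ny]] := @nbr_pick _ e clsQ w l se; first by rewrite Qw.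
  by move: dl poor tl; olia.
have [sy ir] := se.
set e1 := move e i u w; have se1 : simple_graph e1 by apply: move_simple.
have m1 A v := nbr_move se iu wu nu A v; rewrite -/e1 in m1.
have yw : y != w by apply: contraTneq wy => ->.
have wy1 : e1 w y.
  by rewrite /e1 /move wy (eq_sym w i) (nPQ i w) // (negbTE nu).
have ly1 : ~~ e1 l y.
  by rewrite /e1 /move (negbTE ly) (negbTE yw) (nPQ l w) // !andbF.
set e2 := move e1 w y l; have se2 : simple_graph e2 by apply: move_simple.
have m2 A v := nbr_move se1 wy1 ly1 ny A v; rewrite -/e2 in m2.
have Pw : clsP w = false by apply/negbTE.
have Py : clsP y = false by apply/negbTE.
have e2P v : nbr e2 clsP v + (v == i) + (v == u) = cP v + (v == w) + (v == y).
  by have := m2 clsP v; have := m1 clsP v; rewrite Au Pi Pl Pw Py !muln0 !muln1 !addn0; olia.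
have e2Q v : nbr e2 clsQ v + (v == w) + (v == y) = cQ v + (v == u) + (v == l).
  by have := m2 clsQ v; have := m1 clsQ v; rewrite !clsQE Au Pi Pl Pw Py !muln0 !muln1 !addn0; olia.
apply: stuck; exists e2; split=> //.
  apply/balancedE; split=> v Cv.
    have := e2P v; have := e2Q v; have := bal_P Cv.
    by rewrite (nPQ v w) // (nPQ v y) //; olia.
  have := e2P v; have := e2Q v; have := bal_Q Cv.
  by rewrite !(eq_sym v) (nPQ i v) // (nPQ u v) // (nPQ l v) //; olia.
by move=> v; rewrite !deg_PQ; have := e2P v; have := e2Q v; olia.
Qed.

Lemma same_class_false : False.
Proof.
have [ti tl] := tight_il.
have Tl : tailP l by rewrite /tailP -/(clsP l) Pl /= ltnW.
have hP : \sum_(u | tailP u) cQ u + kP * ~~ odd i + 2 <= \sum_(u | tailP u) cP u + kP.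
  have := sum_indic tailP i 1; have := sum_indic tailP l 1; rewrite tailP_i Tl => E1 E2.
  rewrite -[2]/(1 * true + 1 * true) -{1}E1 -E2 -sum_const_cond addnA -!big_split /=.
  apply: leq_sum => u Tu; have := tailP_not_rich Tu.
  case: (eqVneq u l) => [->|_]; first by rewrite eq_sym (negbTE il_neq) tl; olia.
  by case: (eqVneq u i) => [->|_]; [rewrite ti|]; olia.
have hQ : \sum_(u | tailQ u) cQ u + kQ * 2 <= \sum_(u | tailQ u) cP u + kQ * odd i.
  rewrite -!sum_const_cond -!big_split /=.
  by apply: leq_sum => u Tu; apply: tailQ_rich.
(* As kP = kQ + 1, the two bounds give SQ - SP at most -1 for odd i and at most -(n - i) - 2 for
   even i, both out of range. *)
have := tail_sum_rel; rewrite !tail_split.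
have : kP = kQ + (odd n == odd i) := parity_count i.
rewrite li eqxx; have := tail_count; move: hP hQ.
by case: (odd i) => /=; clear; rewrite ?muln0 ?muln1; lia.
Qed.

End SameClass.

Lemma neq_PQ u v : clsP u -> clsQ v -> (u == v) = false.
Proof. by move=> Pu Qv; apply/negbTE; apply: contraTneq Qv => <-; rewrite clsQE Pu. Qed.

Lemma cls_odd u v : clsP u -> clsP v -> odd u = odd v.
Proof. by move=> /eqP -> /eqP ->. Qed.

Lemma clsQ_odd u v : clsQ u -> clsQ v -> odd u = odd v.
Proof. by rewrite /clsQ; case: (odd u); case: (odd v); case: (odd i). Qed.

(** * The case where i and n have different parities *)

Section DiffClass.
Hypothesis li : odd n != odd i.

Lemma clsQ_l : clsQ l. Proof. exact: li. Qed.

(* A unit moved from tailP to tailQ, b to a, suffices: moves inside the two classes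
   then carry i to b and a to l. *)
Lemma exchange_stuck e1 b a : simple_graph e1 -> tailP b -> tailQ a ->
  (forall v, deg e1 v + (v == b) = deg e v + (v == a)) ->
  (forall v, v != b -> v != a -> same e1 v <= cross e1 v + ~~ odd v) ->
  same e1 b <= cross e1 b + ~~ odd b + (b != i) ->
  same e1 a <= cross e1 a + ~~ odd a + (a != l) ->
  (b != i -> (same e1 i < cross e1 i + ~~ odd i) || (same e1 b < cross e1 b + ~~ odd b)) ->
  (a != l -> (same e1 a < cross e1 a + ~~ odd a) || (same e1 l < cross e1 l + ~~ odd l)) ->
  False.
Proof.
move=> se1 Tb Ta dg ot sb sa rb ra; apply: stuck.
have Ql := clsQ_l; have Pi : clsP i by case/andP: tailP_i.
have /andP[Pb ib] := Tb; have /andP[Qa ia] := Ta; rewrite -/(clsP b) -/(clsQ a) in Pb Qa.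
have [e2 [se2 dg2 sP sQ]] : exists e2, [/\ simple_graph e2,
    forall v, deg e2 v + (v == i) = deg e v + (v == a),
    forall v, clsP v -> same e2 v <= cross e2 v + ~~ odd v &
    forall v, clsQ v -> same e2 v = same e1 v /\ cross e2 v = cross e1 v].
  case: (eqVneq b i) sb rb => [bi|bi] sb rb.
    exists e1; split=> //; first by move=> v; rewrite -dg bi.
    move=> v Pv; case: (eqVneq v b) => [->|vb]; first by rewrite addn0 in sb.
    by apply: ot => //; rewrite neq_PQ.
  have dib : deg e1 b + 2 <= deg e1 i.
    have := tailP_deg Tb bi; have := dg b; have := dg i.
    rewrite eqxx (eq_sym i b) (negbTE bi) (neq_PQ Pb Qa) (neq_PQ Pi Qa); olia.
  have si : same e1 i <= cross e1 i + ~~ odd i by apply: ot; [rewrite eq_sym|rewrite neq_PQ].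
  have [|e2 [se2 si2 sb2 dg2 ot2]] := same_class_move se1 (cls_odd Pi Pb) dib _ sb (rb isT).
    by apply: leq_trans si _; rewrite leq_addr.
  exists e2; split=> //.
  - by move=> v; have := dg2 v; have := dg v; olia.
  - move=> v Pv; case: (eqVneq v i) => [->//|vi]; case: (eqVneq v b) => [->//|vb].
    by have [-> ->] := ot2 v vi vb; apply: ot => //; rewrite neq_PQ.
  by move=> v Qv; apply: ot2; rewrite eq_sym neq_PQ.
case: (eqVneq a l) sa ra => [al|al] sa ra.
  exists e2; split=> //; last by move=> v; rewrite dg2 al.
  move=> v; case: (boolP (clsP v)) => Cv; first exact: sP.
  have [-> ->] := sQ v Cv; case: (eqVneq v a) => [->|va]; first by rewrite addn0 in sa.
  by apply: ot => //; rewrite eq_sym neq_PQ.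
have dal : deg e2 l + 2 <= deg e2 a.
  have := tail_deg_l ia al; have := dg2 a; have := dg2 l.
  rewrite eqxx (eq_sym l a) (negbTE al) !(eq_sym _ i) (neq_PQ Pi Qa) (neq_PQ Pi Ql); olia.
have sl : same e1 l <= cross e1 l + ~~ odd l by apply: ot; [rewrite eq_sym neq_PQ|rewrite eq_sym].
have [sa2 ca2] := sQ a Qa; have [sl2 cl2] := sQ l Ql.
rewrite -sa2 -ca2 -sl2 -cl2 in sa sl ra.
have [|e3 [se3 sa3 sl3 dg3 ot3]] := same_class_move se2 (clsQ_odd Qa Ql) dal sa _ (ra isT).
  by apply: leq_trans sl _; rewrite leq_addr.
exists e3; split=> //; last by move=> v; have := dg3 v; have := dg2 v; olia.
move=> v; case: (eqVneq v a) => [->//|va]; case: (eqVneq v l) => [->//|vl].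
have [-> ->] := ot3 v va vl; case: (boolP (clsP v)) => Cv; first exact: sP.
by have [-> ->] := sQ v Cv; apply: ot => //; rewrite eq_sym neq_PQ.
Qed.

(** Otherwise y-b could be replaced by y-a: b loses a same-class neighbour, a gains one across, and
    y trades the former kind for the latter. All three gain slack, so [exchange_stuck] applies. *)
Lemma adj_PtoQ y b a : clsP y -> tailP b -> tailQ a -> e y b -> e y a.
Proof.
move=> Py Tb Ta yb; apply/negPn/negP => ya; have [sy ir] := se.
have /andP[Pb ib] := Tb; have /andP[Qa ia] := Ta; rewrite -/(clsP b) -/(clsQ a) in Pb Qa.
have byE : e b y by rewrite sy.
have nay : ~~ e a y by rewrite sy.
have ny : a != y by rewrite eq_sym neq_PQ.
have [sb sa sy1 so] := same_move_at se byE nay ny.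
have [cb ca cy co] := cross_move_at se byE nay ny.
have oyb := cls_odd Py Pb; have oba : (odd b == odd a) = false.
  by move: (Pb) (Qa); rewrite /clsP /clsQ; case: (odd b); case: (odd a); case: (odd i).
have bb := bal b; have ba := bal a; rewrite (eq_sym (odd a)) in sy1 cy.
rewrite oyb ?eqxx ?oba /= in sa ca sb cb sy1 cy.
have se1 : simple_graph (move e b y a) by apply: move_simple.
apply: (@exchange_stuck (move e b y a) b a se1 Tb Ta).
- exact: deg_move.
- move=> v vb va; case: (eqVneq v y) => [->|vy]; last by rewrite so ?co.
  by move: sy1 cy (bal y); rewrite oyb; olia.
- by move: sb cb bb; olia.
- by move: sa ca ba; olia.
- by move=> _; apply/orP; right; move: sb cb bb; olia.
by move=> _; apply/orP; left; move: sa ca ba; olia.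
Qed.

(** Here replacing y-b by y-a costs y two units and b and a one each. The slack of y pays for y,
    that of i for b, and that of a or of n for a. If y is n itself, it needs a third unit for that
    repair. *)
Lemma adj_rich y b a : clsQ y -> cQ y + 2 <= cP y + odd i -> tailP b -> tailQ a -> a != y ->
  cP i < cQ i + ~~ odd i ->
  cQ a + 2 <= cP a + odd i \/ cQ l < cP l + odd i /\ (y = l -> cQ l + 3 <= cP l + odd i) ->
  e y b -> e y a.
Proof.
move=> Qy ry Tb Ta ny ri ral yb; apply/negPn/negP => ya; have [sy ir] := se.
have Ql := clsQ_l; have Pi : clsP i by case/andP: tailP_i.
have /andP[Pb ib] := Tb; have /andP[Qa ia] := Ta; rewrite -/(clsP b) -/(clsQ a) in Pb Qa.
have byE : e b y by rewrite sy.
have nay : ~~ e a y by rewrite sy.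
set e1 := move e b y a; have se1 : simple_graph e1 by apply: move_simple.
have m A v := nbr_move se byE nay ny A v; rewrite -/e1 in m.
have Py : clsP y = false by apply/negbTE.
have Pa : clsP a = false by apply/negbTE.
have e1P v : nbr e1 clsP v + (v == y) = cP v.
  by have := m clsP v; rewrite Py Pb Pa !muln0 !muln1 !addn0.
have e1Q v : nbr e1 clsQ v + (v == b) = cQ v + (v == a) + (v == y).
  by have := m clsQ v; rewrite !clsQE Py Pb Pa !muln0 !muln1 !addn0.
have sP v : clsP v -> clsP v /\ (v == y) = false /\ (v == a) = false.
  by move=> Pv; rewrite !(neq_PQ Pv).
have sQ v : clsQ v -> (v == b) = false by move=> Qv; rewrite eq_sym neq_PQ.
have nP v : clsP v -> (~~ odd v : nat) = ~~ odd i by move=> /eqP ->.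
have nQ v : clsQ v -> (~~ odd v : nat) = odd i by rewrite /clsQ; case: (odd v); case: (odd i).
apply: (@exchange_stuck e1 b a se1 Tb Ta).
- by move=> v; rewrite !deg_PQ; have := e1P v; have := e1Q v; olia.
- move=> v vb va; have := e1P v; have := e1Q v; rewrite (negbTE vb) (negbTE va).
  case: (boolP (clsP v)) => Cv.
    have [_ [-> _]] := sP v Cv; rewrite same_P // cross_P // nP //.
    by have := bal_P Cv; olia.
  rewrite same_Q // cross_Q // nQ //; have := bal_Q Cv; move: ry.
  by case: eqVneq => [->|_]; olia.
- rewrite same_P // cross_P // nP //; have := e1P b; have := e1Q b; have := bal_P Pb; move: ri.
  by have [_ [-> ->]] := sP b Pb; rewrite eqxx; case: eqVneq => [->|_]; olia.
- rewrite same_Q // cross_Q // nQ //; have := e1P a; have := e1Q a; have := bal_Q Qa; move: ral.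
  rewrite (negbTE ny) sQ // eqxx; case: eqVneq => [->|_]; last by olia.
  by case=> [|[]]; olia.
- move=> bi; apply/orP; left.
  rewrite same_P // cross_P //; have := e1P i; have := e1Q i; move: ri.
  by have [_ [-> ->]] := sP i Pi; rewrite eq_sym (negbTE bi); olia.
move=> al; rewrite !same_Q // !cross_Q // !nQ //.
case: ral => [ra|[rl ryl]]; apply/orP; [left|right].
  by have := e1P a; have := e1Q a; rewrite (negbTE ny) sQ // eqxx; move: ra; olia.
have := e1P l; have := e1Q l; rewrite sQ // (eq_sym l a) (negbTE al); move: rl.
by case: (eqVneq l y) => [ly|_]; [have := ryl (esym ly)|]; olia.
Qed.

Lemma not_oddP v : clsP v -> (~~ odd v : nat) = ~~ odd i.
Proof. by move=> /eqP ->. Qed.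

Lemma not_oddQ v : clsQ v -> (~~ odd v : nat) = odd i.
Proof. by rewrite /clsQ; case: (odd v); case: (odd i). Qed.

Lemma kPQ : kP = kQ.
Proof.
have : kP = kQ + (odd n == odd i) := parity_count i.
by rewrite (negbTE li) addn0.
Qed.

Lemma tailP_cls b : tailP b -> clsP b. Proof. by case/andP. Qed.
Lemma tailQ_cls a : tailQ a -> clsQ a. Proof. by case/andP. Qed.

Lemma tailQ_gt_i a : tailQ a -> i < a.
Proof.
move=> /andP[Qa ia]; rewrite ltn_neqAle ia andbT.
have Pi : clsP i by apply: tailP_cls tailP_i.
by have := neq_PQ Pi Qa => /negbT.
Qed.

Lemma tailP_neq_l b : tailP b -> b != l.
Proof. by move=> /tailP_cls Pb; rewrite neq_PQ // clsQ_l. Qed.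

Lemma tailP_lt b : tailP b -> b < n.
Proof.
move=> /tailP_neq_l bl; rewrite ltn_neqAle -ltnS ltn_ord andbT.
by apply: contraNneq bl => h; apply/eqP/val_inj.
Qed.

Lemma tail_succ (b : 'I_n.+1) : tailP b -> tailQ (inord b.+1) /\ (inord b.+1 : 'I_n.+1) = b.+1 :> nat.
Proof.
move=> Tb; have bn := tailP_lt Tb; rewrite /tailQ inordK //; split=> //.
case/andP: Tb => /eqP ob ib; rewrite leqW // andbT /= -ob; by case: (odd b).
Qed.

Lemma tail_pred (a : 'I_n.+1) : tailQ a ->
  tailP (inord a.-1) /\ ((inord a.-1 : 'I_n.+1).+1 = a).
Proof.
move=> Ta; have ia := tailQ_gt_i Ta; have a0 : 0 < a by apply: leq_ltn_trans ia.
have an : a.-1 < n.+1 by apply: leq_ltn_trans (ltn_ord a); apply: leq_pred.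
rewrite /tailP inordK // prednK //; split=> //.
case/andP: Ta => oa _; move: oa ia; rewrite -{1 2}(prednK a0) ltnS => oa ->.
by move: oa; rewrite /= andbT; case: (odd a.-1); case: (odd i).
Qed.

Lemma sum_tailQ f : \sum_(u | tailQ u) f u = \sum_(u | tailP u) f (inord (nat_of_ord u).+1).
Proof. exact: parity_shift. Qed.

Lemma sum_tailP f : \sum_(u | tailP u) f u = \sum_(u | tailQ u) f (inord (nat_of_ord u).-1).
Proof.
rewrite sum_tailQ; apply: eq_bigr => u Tu; have [_ ->] := tail_succ Tu.
by rewrite inord_val.
Qed.

Lemma tP_le_tQ y : clsP y -> tP y <= tQ y.
Proof.
move=> Py; case: (posnP (tP y)) => [->//|/nbr_gt0[b Tb yb]].
apply: (@leq_trans kQ); first by rewrite -kPQ; apply: leq_sum => u _; case: (e y u).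
by apply: leq_sum => a Ta; rewrite (adj_PtoQ Py Tb Ta yb).
Qed.

(** By [adj_PtoQ] every neighbour of i in its own class is a neighbour of a. Tightness makes these
    at least half of the degree of i, and a has smaller degree, which leaves it few neighbours in
    its own class. *)
Lemma tight_i_rich a : cP i = cQ i + ~~ odd i -> tailQ a -> cQ a + 2 <= cP a + odd i.
Proof.
move=> ti Ta; have [sy _] := se.
have : cP i <= cP a.
  apply: leq_sum => u Pu; case iu : (e i u) => //.
  by rewrite sy (adj_PtoQ Pu tailP_i Ta) // sy.
have := deg_i (tailQ_gt_i Ta); rewrite !deg_PQ; move: ti.
by case: (odd i) => /=; olia.
Qed.

Lemma tight_l_rich b : cQ l = cP l + odd i -> tailP b -> cP b + 2 <= cQ b + ~~ odd i.
Proof.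
move=> tl Tb; have [sy _] := se; have /andP[Pb ib] := Tb.
have Tl : tailQ l by rewrite /tailQ -/(clsQ l) clsQ_l /= ltnW.
have : cP b <= cP l.
  apply: leq_sum => u Pu; case bu : (e b u) => //.
  by rewrite sy (adj_PtoQ Pu Tb Tl) // sy.
have := tail_deg_l ib (tailP_neq_l Tb); rewrite !deg_PQ; move: tl.
by case: (odd i) => /=; olia.
Qed.

(** * Chains through the head when the tail spans no edge *)

Section NoTailEdges.
Hypothesis flat : forall u : 'I_n.+1, i <= u -> tP u + tQ u = 0.

Lemma flat_cQ (u : 'I_n.+1) : i <= u -> nbr e headQ u = cQ u.
Proof. by move=> /flat /eqP; rewrite addn_eq0 nbr_clsQ => /andP[_ /eqP ->]; rewrite addn0. Qed.

Lemma headQ_cls z : headQ z -> clsQ z. Proof. by case/andP. Qed.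

Lemma headQ_NtailP u : headQ u -> ~~ tailP u.
Proof. by case/andP=> _ ui; rewrite negb_and -ltnNge ui orbT. Qed.

Lemma headQ_NtailQ u : headQ u -> ~~ tailQ u.
Proof. by case/andP=> _ ui; rewrite negb_and -ltnNge ui orbT. Qed.

Lemma tailP_NtailQ u : tailP u -> ~~ tailQ u.
Proof. by move/tailP_cls => Pu; rewrite negb_and -/(clsQ u) clsQE Pu. Qed.

Lemma headQ_surplus z : headQ z -> tQ z < tP z -> cQ z + 2 <= cP z + odd i.
Proof.
move=> Rz lt; have := slack_Q (headQ_cls Rz); have /andP[_ ->] := Rz.
case: (posnP (tP z + tQ z)) => [h|_ /(_ isT)]; first by move: lt h; olia.
by move: lt; olia.
Qed.

Lemma headQ_neq (z u : 'I_n.+1) : headQ z -> i <= u -> (z == u) = false.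
Proof. by case/andP=> _ zi iu; apply/negbTE; apply: contraTneq zi => ->; rewrite -leqNgt. Qed.

(** First t takes a same-class neighbour from i, then [chain] carries the excess of t through rows
    in headQ to some a in tailQ. In all t pays 2, the crossing row pays 2 (it has them by
    [headQ_surplus]), and a pays 1 of its slack of at least 2, keeping one for the final step to
    n. *)
Lemma flat_tight_i t : cP i = cQ i + ~~ odd i ->
  tailP t -> cP t + 2 <= cQ t + ~~ odd i -> False.
Proof.
move=> ti Tt rt; have Pi := tailP_cls tailP_i; have Pt := tailP_cls Tt; have /andP[_ it] := Tt.
have nti : t != i by apply: contraTneq rt => ->; rewrite ti; olia.
have [//||u [Pu iu tu nu]] := @nbr_pick _ e clsP i t se.
  by have := tailP_deg Tt nti; rewrite !deg_PQ; move: rt ti; olia.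
set e1 := move e i u t; have se1 : simple_graph e1 by apply: move_simple.
have m A v := nbr_move se iu tu nu A v; rewrite -/e1 in m.
have e1P v : nbr e1 clsP v + (v == i) = cP v + (v == t).
  by have := m clsP v; rewrite Pu Pi Pt !muln1; olia.
have e1Q v : nbr e1 clsQ v = cQ v.
  by have := m clsQ v; rewrite !clsQE Pu Pi Pt !muln0 !addn0.
have e1H v : nbr e1 headQ v = nbr e headQ v.
  have N w : clsP w -> headQ w = false by move=> Pw; apply/negbTE; rewrite negb_and -/(clsQ w) clsQE Pw.
  by have := m headQ v; rewrite !N // !muln0 !addn0.
have e1z A z : headQ z -> nbr e1 A z = nbr e A z.
  move=> Rz; have Qz := headQ_cls Rz; have := m A z.
  by rewrite !(eq_sym z) !(neq_PQ _ Qz) // !mul0n !addn0.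
(* Without tail edges these counts are [cQ]: small at the successor, which is rich, and about half
   the degree or more at b, which is balanced. *)
have gap b : tailP b -> nbr e1 headQ (inord b.+1) < nbr e1 headQ b.
  move=> Tb; have [Ta ab] := tail_succ Tb; rewrite !e1H.
  have /andP[Pb ib] := Tb; have /andP[Qa ia] := Ta; rewrite !flat_cQ //.
  have ba : b <= (inord b.+1 : 'I_n.+1) by rewrite ab.
  have := tight_i_rich ti Ta; have := mono ba; have := bal_P Pb; rewrite !deg_PQ.
  by case: (odd i) => /=; olia.
have [e2 [z [b [se2 Rz Tb lz upd]]]] := chain (fun b Tb => (tail_succ Tb).1) sum_tailQ
  headQ_NtailP headQ_NtailQ tailP_NtailQ (leqnn _) se1 Tt (fun b Tb => ltnW (gap b Tb)) (gap t Tt).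
rewrite !e1z // in lz; have rz := headQ_surplus Rz lz; have Qz := headQ_cls Rz.
have [Ta ab] := tail_succ Tb; set a := inord b.+1 in Ta ab upd.
have Qa := tailQ_cls Ta; have /andP[_ ia] := Ta.
have Pz : clsP z = false by apply/negbTE.
have Pa : clsP a = false by apply/negbTE.
have e2P v : nbr e2 clsP v + (v == i) + (v == z) = cP v + (v == t).
  have := upd clsP _ _ v; rewrite Pz Pt Pa !muln0 muln1 !addn0; have := e1P v.
  move=> h1 h2; have := h2 _ _; move: h1; clear h2 => h1 h2.
  have {}h2 := h2 (fun x y Hx Hy => etrans (tailP_cls Hx) (esym (tailP_cls Hy))).
  have {}h2 := h2 (fun x y Hx Hy => etrans (negbTE (headQ_cls Hx)) (esym (negbTE (headQ_cls Hy)))).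
  by move: h1 h2; olia.
have e2Q v : nbr e2 clsQ v + (v == t) = cQ v + (v == a) + (v == z).
  have h1 := upd clsQ
    (fun x y Hx Hy => congr1 negb (etrans (tailP_cls Hx) (esym (tailP_cls Hy))))
    (fun x y Hx Hy => etrans (headQ_cls Hx) (esym (headQ_cls Hy))) v.
  by move: h1; rewrite !clsQE Pz Pt Pa !muln0 !muln1 !addn0 e1Q.
have ra := tight_i_rich ti Ta.
apply: (@exchange_stuck e2 i a se2 tailP_i Ta).
- by move=> v; rewrite !deg_PQ; have := e2P v; have := e2Q v; olia.
- move=> v vi va; have := e2P v; have := e2Q v; rewrite (negbTE vi) (negbTE va).
  case: (boolP (clsP v)) => Cv.
    rewrite same_P // cross_P // not_oddP // (neq_PQ Cv Qz).
    have := bal_P Cv; move: rt; by case: (eqVneq v t) => [->|_]; olia.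
  rewrite same_Q // cross_Q // not_oddQ // (eq_sym v t) (neq_PQ Pt Cv).
  have := bal_Q Cv; move: rz; by case: (eqVneq v z) => [->|_]; olia.
- rewrite same_P // cross_P // eqxx; have := e2P i; have := e2Q i.
  by rewrite (eq_sym i t) (negbTE nti) (neq_PQ Pi Qa) (neq_PQ Pi Qz) eqxx; move: ti; olia.
- rewrite same_Q // cross_Q // not_oddQ //; have := e2P a; have := e2Q a.
  by rewrite eqxx (eq_sym a z) (headQ_neq Rz ia) (eq_sym a t) (neq_PQ Pt Qa) (eq_sym a i) (neq_PQ Pi Qa); move: ra; olia.
- by rewrite eqxx.
move=> _; apply/orP; left.
rewrite same_Q // cross_Q // not_oddQ //; have := e2P a; have := e2Q a.
by rewrite eqxx (eq_sym a z) (headQ_neq Rz ia) (eq_sym a t) (neq_PQ Pt Qa) (eq_sym a i) (neq_PQ Pi Qa); move: ra; olia.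
Qed.

(* The chain runs in the complement, with the roles of tailP and tailQ exchanged. *)
Lemma flat_tight_l t : cQ l = cP l + odd i ->
  tailQ t -> cQ t + 2 <= cP t + odd i -> False.
Proof.
move=> tl Tt rt; have Ql := clsQ_l; have Qt := tailQ_cls Tt; have /andP[_ it] := Tt.
have ntl : t != l by apply: contraTneq rt => ->; rewrite tl; olia.
have Pl : clsP l = false by apply/negbTE.
have Pt : clsP t = false by apply/negbTE.
have il' : i <= l by apply: ltnW.
have [||u [Pu tu lu nu]] := @nbr_pick _ e clsP t l se; first by rewrite Pl.
  by have := tail_deg_l it ntl; rewrite !deg_PQ; move: rt tl; olia.
(* Having given u to n, t is one unit short, which is an excess in the complement. *)
set e1 := move e t u l; have se1 : simple_graph e1 by apply: move_simple.
have m A v := nbr_move se tu lu nu A v; rewrite -/e1 in m.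
have e1P v : nbr e1 clsP v + (v == t) = cP v + (v == l).
  by have := m clsP v; rewrite Pu Pl Pt !muln1; olia.
have e1Q v : nbr e1 clsQ v = cQ v.
  by have := m clsQ v; rewrite !clsQE Pu Pl Pt !muln0 muln1; olia.
have Hu : headQ u = false by apply/negbTE; rewrite negb_and -/(clsQ u) clsQE Pu.
have Ht (w : 'I_n.+1) : i <= w -> headQ w = false by move=> iw; rewrite /headQ ltnNge iw andbF.
have e1H v : nbr e1 headQ v = nbr e headQ v.
  by have := m headQ v; rewrite Hu !Ht // !muln0 !addn0.
have e1z A z : headQ z -> nbr e1 A z = nbr e A z.
  move=> Rz; have Qz := headQ_cls Rz; have := m A z.
  by rewrite (headQ_neq Rz it) (headQ_neq Rz il') (eq_sym z u) (neq_PQ Pu Qz) !mul0n !addn0.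
have gap a : tailQ a -> nbr (compl e1) headQ (inord a.-1) < nbr (compl e1) headQ a.
  move=> Ta; have [Tb ab] := tail_pred Ta.
  have /andP[Qa ia] := Ta; have /andP[Pb ib] := Tb.
  have := nbr_compl headQ a se1; have := nbr_compl headQ (inord a.-1) se1.
  rewrite !Ht // !e1H !flat_cQ //.
  have ba : (inord a.-1 : 'I_n.+1) <= a by apply: leq_trans (leqnSn _) _; rewrite ab.
  have := tight_l_rich tl Tb; have := mono ba; have := bal_Q Qa; rewrite !deg_PQ.
  by case: (odd i) => /=; olia.
have [e2 [z [a [se2 Rz Ta lz upd]]]] := chain (fun a Ta => (tail_pred Ta).1) sum_tailP
  headQ_NtailQ headQ_NtailP (fun u => contraL (@tailP_NtailQ u)) (leqnn _) (compl_simple se1) Tt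
  (fun b Tb => ltnW (gap b Tb)) (gap t Tt).
have [Tb ab] := tail_pred Ta; set b := inord a.-1 in Tb ab upd.
have Pb := tailP_cls Tb; have /andP[_ ib] := Tb; have Qz := headQ_cls Rz.
have Pz : clsP z = false by apply/negbTE.
have {}lz : tQ z < tP z.
  have {}lz : nbr (compl e1) tailP z < nbr (compl e1) tailQ z := lz.
  have := nbr_compl tailP z se1; have := nbr_compl tailQ z se1.
  rewrite !e1z // kPQ (negbTE (headQ_NtailP Rz)) (negbTE (headQ_NtailQ Rz)); move: lz; olia.
have rz := headQ_surplus Rz lz.
have se3 : simple_graph (compl e2) by apply: compl_simple.
have e3P v : nbr (compl e2) clsP v + (v == z) + (v == t) = cP v + (v == l).
  have := upd clsP
    (fun x y Hx Hy => etrans (negbTE (tailQ_cls Hx)) (esym (negbTE (tailQ_cls Hy))))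
    (fun x y Hx Hy => etrans (negbTE (headQ_cls Hx)) (esym (negbTE (headQ_cls Hy)))) v.
  rewrite Pz Pt Pb !muln0 muln1 !addn0.
  by have := nbr_compl clsP v se1; have := nbr_compl clsP v se2; have := e1P v; olia.
have e3Q v : nbr (compl e2) clsQ v + (v == b) = cQ v + (v == t) + (v == z).
  have := upd clsQ
    (fun x y Hx Hy => etrans (tailQ_cls Hx) (esym (tailQ_cls Hy)))
    (fun x y Hx Hy => etrans (headQ_cls Hx) (esym (headQ_cls Hy))) v.
  rewrite !clsQE Pz Pt Pb !muln0 !muln1 !addn0.
  by have := nbr_compl clsQ v se1; have := nbr_compl clsQ v se2; have := e1Q v; olia.
have rb := tight_l_rich tl Tb.
have Tl : tailQ l by rewrite /tailQ -/(clsQ l) Ql.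
apply: (@exchange_stuck (compl e2) b l se3 Tb Tl).
- by move=> v; rewrite !deg_PQ; have := e3P v; have := e3Q v; olia.
- move=> v vb vl; have := e3P v; have := e3Q v; rewrite (negbTE vb) (negbTE vl).
  case: (boolP (clsP v)) => Cv.
    rewrite same_P // cross_P // not_oddP // !(neq_PQ Cv) //.
    by have := bal_P Cv; olia.
  rewrite same_Q // cross_Q // not_oddQ //.
  have := bal_Q Cv; move: rz rt; case: (eqVneq v z) => [->|_]; case: (eqVneq _ t) => [E|_]; rewrite ?E; last by olia.
  + by move: (headQ_neq Rz it); rewrite E eqxx.
  + by olia.
  by olia.
- rewrite same_P // cross_P // not_oddP //; have := e3P b; have := e3Q b.
  by rewrite eqxx (neq_PQ Pb Qt) (neq_PQ Pb Qz) (neq_PQ Pb Ql); move: rb; olia.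
- rewrite same_Q // cross_Q // not_oddQ //; have := e3P l; have := e3Q l.
  rewrite (eq_sym l z) (headQ_neq Rz il') (eq_sym l t) (negbTE ntl) (eq_sym l b) (neq_PQ Pb Ql) eqxx.
  by move: tl; olia.
- move=> _; apply/orP; right.
  rewrite same_P // cross_P // not_oddP //; have := e3P b; have := e3Q b.
  by rewrite eqxx (neq_PQ Pb Qt) (neq_PQ Pb Qz) (neq_PQ Pb Ql); move: rb; olia.
by rewrite eqxx.
Qed.

End NoTailEdges.

Lemma flat_of_i : tP i + tQ i = 0 -> forall u : 'I_n.+1, i <= u -> tP u + tQ u = 0.
Proof. by move=> h u iu; apply/eqP; rewrite -leqn0 -h; apply: tail_mono. Qed.

Lemma tight_i_false : cP i = cQ i + ~~ odd i -> False.
Proof.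
move=> ti; have Pi := tailP_cls tailP_i.
(* With a tail neighbour, i would have slack [1 + tQ i - tP i], which is positive by [tP_le_tQ]. *)
have fl : tP i + tQ i = 0.
  case: (posnP (tP i + tQ i)) => // h.
  have := slack_P Pi h; have := tP_le_tQ Pi; rewrite ltnn ti; olia.
case: (pickP [pred t | tailP t && (cP t + 2 <= cQ t + ~~ odd i)]) => [t /andP[Tt rt]|no].
  exact: flat_tight_i (flat_of_i fl) t ti Tt rt.
have hP : \sum_(u | tailP u) cQ u + kP * ~~ odd i + 1 <= \sum_(u | tailP u) cP u + kP.
  have := sum_indic tailP i 1; rewrite tailP_i => E.
  rewrite -[X in _ + X <= _]/(1 * true) -E -sum_const_cond -!big_split /=.
  apply: leq_sum => u Tu; have := no u; rewrite /= Tu /= => /negbT; rewrite -ltnNge.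
  by case: (eqVneq u i) => [->|_]; [rewrite ti|]; olia.
have hQ : \sum_(u | tailQ u) cQ u + kQ * 2 <= \sum_(u | tailQ u) cP u + kQ * odd i.
  rewrite -!sum_const_cond -!big_split /=.
  by apply: leq_sum => u Tu; apply: tight_i_rich.
have := tail_sum_rel; rewrite !tail_split; have := tail_count; have := kPQ; move: hP hQ.
by case: (odd i) => /=; clear; rewrite ?muln0 ?muln1; lia.
Qed.

(** * Counting the edges inside the two halves of the tail *)

Lemma tail_deg_sum : \sum_(u | tailQ u) deg e u + 2 <= \sum_(u | tailP u) deg e u.
Proof.
(* F is the target degree sequence on the tail, still nonincreasing because i and n have strictly
   extreme degrees. Its alternating sum is nonnegative, and undoing the two corrections yields the
   2. *)
pose F (u : 'I_n.+1) := deg e u - (u == i) + (u == l).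
have Fm (u v : 'I_n.+1) : i <= u -> u <= v -> F v <= F u.
  move=> iu uv; rewrite /F; case: (eqVneq u v) => [->//|nuv].
  have uv' : u < v by rewrite ltn_neqAle uv andbT.
  have vi : v == i = false by apply/negbTE; apply: contraTneq uv' => ->; rewrite -leqNgt.
  have ul : u == l = false.
    by apply/negbTE; apply: contraTneq uv' => ->; rewrite -leqNgt -ltnS ltn_ord.
  rewrite vi ul subn0 addn0.
  case: (eqVneq u i) => [ui|ui]; case: (eqVneq v l) => [->|vl].
  - by have := deg_il; rewrite ui; olia.
  - by have := @deg_i v; rewrite -ui uv' => /(_ isT); olia.
  - by have := tail_deg_l iu (negbT ul); olia.
  by have := mono uv; olia.
have /andP[h _] := @parity_sum _ F i Fm.
have {}h : \sum_(u | tailQ u) F u <= \sum_(u | tailP u) F u := h.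
have Tl : tailQ l by rewrite /tailQ -/(clsQ l) clsQ_l /= ltnW.
have hP : \sum_(u | tailP u) F u + 1 = \sum_(u | tailP u) deg e u.
  have := sum_indic tailP i 1; rewrite tailP_i muln1 => E.
  rewrite -[X in _ + X = _]E -big_split.
  apply: eq_bigr => u Tu; rewrite /F /= (negbTE (tailP_neq_l Tu)).
  by have := deg_il; case: eqVneq => [->|_]; olia.
have hQ : \sum_(u | tailQ u) F u = \sum_(u | tailQ u) deg e u + 1.
  have := sum_indic tailQ l 1; rewrite Tl muln1 => E.
  rewrite -[X in _ = _ + X]E -big_split.
  apply: eq_bigr => u Tu; rewrite /F /= (eq_sym u i).
  by rewrite (neq_PQ (tailP_cls tailP_i) (tailQ_cls Tu)) subn0 mul1n.
by move: h hP hQ; olia.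
Qed.

Lemma sum_clsP (f : 'I_n.+1 -> nat) :
  \sum_u f u = \sum_(u | headP u) f u + \sum_(u | headQ u) f u +
    (\sum_(u | tailP u) f u + \sum_(u | tailQ u) f u).
Proof.
rewrite -tail_split (bigID (fun u : 'I_n.+1 => u < i)) /=; congr (_ + _).
  exact: (sum_if_split clsP).
by apply: eq_bigl => u; rewrite -leqNgt.
Qed.

(** The degree surplus of tailP cannot come from edges to the head, and the edges between the two
    halves count equally for both, so it lies in the edges inside the halves. *)
Lemma tail_edges_surplus : (forall y, headQ y -> tP y <= tQ y) ->
  \sum_(u | tailQ u) tQ u + 2 <= \sum_(u | tailP u) tP u.
Proof.
move=> hQ; have := tail_deg_sum.
have E (A : pred 'I_n.+1) : \sum_(u | A u) deg e u = \sum_u nbr e A u.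
  by rewrite -(nbr_exchange _ predT) //; apply: eq_bigr => u _; rewrite nbrT.
rewrite !E !sum_clsP; rewrite (nbr_exchange tailP tailQ se).
have : \sum_(u | headP u) tP u <= \sum_(u | headP u) tQ u.
  by apply: leq_sum => u /andP[Pu _]; apply: tP_le_tQ.
have : \sum_(u | headQ u) tP u <= \sum_(u | headQ u) tQ u by apply: leq_sum.
by olia.
Qed.

(** These x vertices carry all edges inside tailP, hence at most x(x-1)/2, yet [adj_PtoQ] joins each
    of them to all of tailQ. *)
Definition linkP : pred 'I_n.+1 := fun u => tailP u && (0 < tP u).
Notation kX := (\sum_(u | linkP u) 1).

Lemma linkP_adj b a : linkP b -> tailQ a -> e b a.
Proof.
by case/andP=> Tb /nbr_gt0[b' Tb' bb'] Ta; apply: adj_PtoQ (tailP_cls Tb) Tb' Ta bb'.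
Qed.

Lemma linkP_le : kX <= kP.
Proof. by rewrite [X in _ <= X](bigID (fun u => 0 < tP u)) /= leq_addr. Qed.

Lemma nbr_count_lt (A : pred 'I_n.+1) v : A v -> nbr e A v + 1 <= \sum_(u | A u) 1.
Proof.
move=> Av; have [_ ir] := se; have := sum_indic A v 1; rewrite Av muln1 => E.
rewrite -[X in _ + X <= _]E -big_split /=; apply: leq_sum => u _.
by case: (eqVneq u v) => [->|_]; rewrite ?(negbTE (ir v)); case: (e v u).
Qed.

Lemma linkP_edges : \sum_(u | tailP u) tP u + kX <= kX * kX.
Proof.
have -> : \sum_(u | tailP u) tP u = \sum_(u | linkP u) tP u.
  rewrite (bigID (fun u => 0 < tP u)) /= addnC big1 // => u /andP[_].
  by rewrite -leqNgt leqn0 => /eqP.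
rewrite -sum_const_cond -big_split /=; apply: leq_sum => b Xb.
have -> : tP b = nbr e linkP b.
  have [sy _] := se; have /andP[Tb _] := Xb.
  rewrite (nbr_split _ _ (fun u => 0 < tP u)) addnC {1}/nbr big1 // => u /andP[_ nt].
  by case bu : (e b u) => //; case/negP: nt; apply: nbr_gt0P Tb _; rewrite sy.
exact: nbr_count_lt.
Qed.

Lemma linkP_tP a : tailQ a -> kX <= tP a.
Proof.
move=> Ta; have [sy _] := se; rewrite /nbr [X in _ <= X](bigID (fun u => 0 < tP u)) /=.
by apply: leq_trans (leq_addr _ _); apply: leq_sum => b Xb; rewrite sy linkP_adj.
Qed.

Lemma tP_bound y : tP y <= kQ.
Proof. by rewrite -kPQ; apply: leq_sum => u _; case: (e y u). Qed.

Lemma tQ_full y : (forall a, tailQ a -> a != y -> e y a) -> kQ <= tQ y + tailQ y.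
Proof.
move=> h; rewrite -(mul1n (nat_of_bool (tailQ y))) -(sum_indic tailQ y 1) -big_split /=.
apply: leq_sum => a Ta; case: (eqVneq a y) => [->|ay]; first by rewrite addnC.
by rewrite h.
Qed.

(** The difference is written [d.+1] because [slack_Q] requires a tail neighbour. *)
Lemma tailQ_slack a d : tailQ a -> tQ a + d.+1 <= tP a -> cQ a + d.+1 <= cP a + odd i.
Proof.
move=> Ta h; have Qa := tailQ_cls Ta; have := tailQ_gt_i Ta; rewrite ltnNge => /negbTE ai.
have pos : 0 < tP a + tQ a by move: h; olia.
have := slack_Q Qa pos; rewrite ltnNge (ltnW (tailQ_gt_i Ta)) /=.
by move: h; olia.
Qed.

(** By [adj_rich], a vertex outside the class of i with too large a surplus of tailP over tailQ
    neighbours would be adjacent to all of tailQ but itself, which destroys that surplus. So tailQ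
    contains almost as many adjacencies as it has towards tailP. *)
Lemma loose_false : cP i < cQ i + ~~ odd i -> cQ l < cP l + odd i -> False.
Proof.
move=> ri rl.
have adj y : clsQ y -> cQ y + 2 <= cP y + odd i -> 0 < tP y ->
    (y = l -> cQ l + 3 <= cP l + odd i) -> kQ <= tQ y + tailQ y.
  move=> Qy ry /nbr_gt0[b Tb yb] yl; apply: tQ_full => a Ta ay.
  by apply: (adj_rich Qy ry Tb Ta ay ri) => //; right.
have hH y : headQ y -> tP y <= tQ y.
  move=> Hy; rewrite leqNgt; apply/negP => lt.
  have yl : y = l -> cQ l + 3 <= cP l + odd i.
    by move=> yl; move: Hy; rewrite yl => /andP[_]; rewrite ltnNge => /negP[]; apply: ltnW.
  have := adj y (headQ_cls Hy) (headQ_surplus Hy lt) (leq_ltn_trans (leq0n _) lt) yl.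
  by rewrite (negbTE (headQ_NtailQ Hy)); have := tP_bound y; move: lt; olia.
have hT a : tailQ a -> tP a <= tQ a + 1 + (a == l).
  move=> Ta; rewrite leqNgt; apply/negP => lt.
  have lt2 : tQ a + 2 <= tP a by move: lt; olia.
  have al : a = l -> cQ l + 3 <= cP l + odd i.
    by move=> al; rewrite -al; apply: tailQ_slack => //; move: lt; rewrite al eqxx; olia.
  have pos : 0 < tP a by move: lt2; olia.
  have := adj a (tailQ_cls Ta) (tailQ_slack Ta lt2) pos al.
  by rewrite Ta; have := tP_bound a; move: lt2; olia.
have Tl : tailQ l by rewrite /tailQ -/(clsQ l) clsQ_l /= ltnW.
have hE : \sum_(u | tailQ u) tP u <= \sum_(u | tailQ u) tQ u + kQ + 1.
  have := sum_indic tailQ l 1; rewrite Tl muln1 addnAC => E.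
  rewrite -[X in _ <= _ + X + _]E.
  by rewrite addnAC -!big_split /=; apply: leq_sum => a Ta; rewrite mul1n; apply: hT.
have hL : kQ * kX <= \sum_(u | tailQ u) tP u.
  by rewrite -sum_const_cond; apply: leq_sum => a Ta; apply: linkP_tP.
have := tail_edges_surplus hH; have := linkP_edges; have := linkP_le; rewrite kPQ.
move: hE hL; clear.
(* Together the bounds say (k - x)(x - 1) < 0, impossible for 1 <= x <= k; and x = 0 leaves no edge
   inside tailP to account for the surplus. *)
move: (kX) (kQ) (\sum_(u | tailQ u) tP u) (\sum_(u | tailQ u) tQ u) (\sum_(u | tailP u) tP u).
move=> x k p q r *; nia.
Qed.

Lemma tailQ_l : tailQ l.
Proof. by rewrite /tailQ -/(clsQ l) clsQ_l /= ltnW. Qed.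

Lemma hd_split v : hd v = nbr e headP v + nbr e headQ v.
Proof.
rewrite (nbr_split _ _ clsP); congr (_ + _); by apply: eq_bigl => u; rewrite andbC.
Qed.

(* Otherwise l is adjacent to the whole head, hence so is every tail vertex, and
   vertex 0 is dominating. *)
Lemma tail_edge_head_empty : cQ l = cP l + odd i -> 0 < tP i + tQ i -> i = 0 :> nat.
Proof.
move=> tl hi; case: (posnP i) => // i0; exfalso; have [sy ir] := se.
have li' : (l < i) = false by rewrite ltnNge ltnW.
have hl : i <= hd l.
  (* If n has no tail neighbour, [adj_PtoQ] passes headP on from i to n, and tightness of n then
     forces all of headQ as well. *)
  case: (posnP (tP l + tQ l)) => [h0|hpos]; last by have := head_eq hpos; rewrite li'; olia.
  have hP : nbr e headP l = \sum_(u | headP u) 1.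
    apply: eq_bigr => u /andP[Pu ui]; rewrite sy (adj_PtoQ Pu tailP_i tailQ_l) //.
    by rewrite sy head_full //; apply: contraTneq ui => ->; rewrite ltnn.
  have hJ : \sum_(u | headQ u) 1 + ~~ odd i = \sum_(u | headP u) 1 + 1 := parity_count_below i.
  have hi' : \sum_(u | headP u) 1 + \sum_(u | headQ u) 1 = i.
    by rewrite -[RHS]sum_below; apply/esym/(sum_if_split clsP).
  rewrite hd_split; move: tl h0; rewrite nbr_clsP nbr_clsQ hP.
  by move: hJ hi'; case: (odd i) => /=; olia.
have i0n : (@ord0 n) < i by [].
have l0 : e l ord0.
  apply/negPn/negP => nl0.
  have := sum_below; have := sum_indic (fun u : 'I_n.+1 => u < i) ord0 1; rewrite i0 => E1.
  suff : hd l + 1 <= \sum_(u : 'I_n.+1 | u < i) 1 by move: hl; olia.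
  rewrite -[X in _ + X <= _]/(1 * true) -E1 -big_split /=; apply: leq_sum => u _.
  by case: eqVneq => [->|_]; rewrite ?(negbTE nl0); case: (e l u).
have := tail_lt ord0; have := tail_count.
have hw w : tailP w || tailQ w -> e ord0 w.
  move=> Tw; have iw : i <= w by case/orP: Tw => /andP[].
  case: (eqVneq w l) => [->|wl]; first by rewrite sy.
  rewrite sy head_full //; first by apply: contraTneq iw => <-; rewrite -ltnNge.
  have := tail_deg_l iw wl; rewrite !deg_head_tail; have := head_le w; move: hl; olia.
have : kP <= tP ord0 by apply: leq_sum => w Tw; rewrite hw // Tw.
have : kQ <= tQ ord0 by apply: leq_sum => w Tw; rewrite hw // Tw orbT.
by olia.
Qed.

Definition richQ : pred 'I_n.+1 := fun a => tailQ a && (tQ a + 2 <= tP a).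
Definition poorQ : pred 'I_n.+1 := fun a => tailQ a && ~~ (tQ a + 2 <= tP a).
Notation kR := (\sum_(u | richQ u) 1).
Notation kN := (\sum_(u | poorQ u) 1).

Lemma sum_rich_poor (f : 'I_n.+1 -> nat) :
  \sum_(u | tailQ u) f u = \sum_(u | richQ u) f u + \sum_(u | poorQ u) f u.
Proof. by rewrite (bigID (fun a => tQ a + 2 <= tP a)). Qed.

Lemma tQ_rich_poor v : tQ v = nbr e richQ v + nbr e poorQ v.
Proof. exact: sum_rich_poor. Qed.

(** A rich endpoint pays for itself in [adj_rich], so nothing is asked of n. *)
Lemma rich_clique : cP i < cQ i + ~~ odd i ->
  kR * kR <= \sum_(a | richQ a) nbr e richQ a + kR.
Proof.
move=> ri; rewrite -sum_const_cond -big_split /=; apply: leq_sum => a Ra.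
have := sum_indic richQ a 1; rewrite Ra => E.
rewrite -[X in _ <= _ + X]/(1 * true) -E -big_split /=; apply: leq_sum => a' Ra'.
case: (eqVneq a' a) => [_|aa]; first by rewrite addn1.
have /andP[Ta ra] := Ra; have /andP[Ta' ra'] := Ra'.
have /nbr_gt0[b Tb ab] : 0 < tP a by move: ra; olia.
rewrite (adj_rich (tailQ_cls Ta) (tailQ_slack Ta ra) Tb Ta' aa ri _ ab) //.
by left; apply: tailQ_slack.
Qed.

(* Otherwise i = 0, and x >= 2 vertices of tailP have a neighbour in tailP; all
   of them are joined to all of tailQ.  The rich vertices of tailQ form a clique
   and each poor one has at least x - 1 neighbours in tailQ, which makes more edges
   inside tailQ than the at most x(x-1)/2 edges inside tailP. *)
Lemma no_tail_edge : cP i < cQ i + ~~ odd i -> cQ l = cP l + odd i -> tP i + tQ i = 0.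
Proof.
move=> ri tl; apply/eqP; rewrite -leqn0 leqNgt; apply/negP => hi.
have i0 := tail_edge_head_empty tl hi; have [sy ir] := se.
have hS : \sum_(u | tailQ u) tQ u + 2 <= \sum_(u | tailP u) tP u.
  by apply: tail_edges_surplus => y /andP[_]; rewrite i0.
have hX := linkP_edges; have hk := linkP_le; rewrite kPQ sum_rich_poor in hk.
have X0 : 0 < kX by move: hX hS; case: (kX) => //; olia.
have poor_l : tP l = tQ l.
  have pos : 0 < tP l + tQ l by rewrite ltn_addr // (leq_trans X0) // linkP_tP // tailQ_l.
  have := slack_Q clsQ_l pos; rewrite tl ltnNge ltnW //=; olia.
have Nl : poorQ l by rewrite /poorQ tailQ_l poor_l /= -ltnNge; olia.
(* Each poor vertex has [tQ] at least x - 1; the additional 1 is n, where tightness gives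
   [tQ = tP]. *)
have hN : kN * kX + 1 <= \sum_(a | poorQ a) nbr e richQ a + \sum_(a | poorQ a) nbr e poorQ a + kN.
  have := sum_indic poorQ l 1; rewrite Nl => E.
  rewrite -[X in _ + X <= _]/(1 * true) -E -sum_const_cond -!big_split /=.
  apply: leq_sum => a /andP[Ta pa]; have := linkP_tP Ta; rewrite -tQ_rich_poor.
  by case: (eqVneq a l) pa => [->|_]; rewrite ?poor_l -ltnNge /= ?muln1 ?muln0; move: (kX) => x; olia.
have hT : \sum_(a | poorQ a) nbr e poorQ a + kN <= kN * kN.
  by rewrite -sum_const_cond -big_split /=; apply: leq_sum => a Na; apply: nbr_count_lt.
have hR := rich_clique ri.
have hQ : \sum_(u | tailQ u) tQ u = \sum_(a | richQ a) nbr e richQ a +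
    2 * \sum_(a | poorQ a) nbr e richQ a + \sum_(a | poorQ a) nbr e poorQ a.
  rewrite sum_rich_poor (eq_bigr _ (fun a _ => tQ_rich_poor a)).
  rewrite [X in _ + X](eq_bigr _ (fun a _ => tQ_rich_poor a)) !big_split /=.
  by rewrite (nbr_exchange richQ poorQ se) mul2n -addnn !addnA.
move: hS hX hk X0 hN hT hR; rewrite hQ; clear.
move: (kX) (kR) (kN) (\sum_(a | richQ a) nbr e richQ a) (\sum_(a | poorQ a) nbr e richQ a)
  (\sum_(a | poorQ a) nbr e poorQ a) (\sum_(u | tailP u) tP u).
move=> x r s A M T P hS hX hk X0 hN hT hR.
(* For x <= s the poor vertices alone have too many neighbours in tailQ. Otherwise x = s + q with q
   <= r, and x(x-1) = s(s-1) + 2sq + q(q-1) is exceeded by s poor vertices together with a clique on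
   r rich ones. *)
case: (leqP x s) => xs; first by nia.
have [q xq] : exists q, x = s + q by exists (x - s); rewrite subnKC // ltnW.
have [y ry] : exists y, r = q + y by exists (r - q); rewrite subnKC //; move: hk; rewrite xq; clear; lia.
by subst x r; nia.
Qed.

Lemma tight_l_false : cP i < cQ i + ~~ odd i -> cQ l = cP l + odd i -> False.
Proof.
move=> ri tl; have fl := no_tail_edge ri tl.
case: (pickP [pred t | tailQ t && (cQ t + 2 <= cP t + odd i)]) => [t /andP[Tt rt]|no].
  exact: flat_tight_l (flat_of_i fl) t tl Tt rt.
have hQ : \sum_(u | tailQ u) cP u + kQ * odd i + 1 <= \sum_(u | tailQ u) cQ u + kQ.
  have := sum_indic tailQ l 1; rewrite tailQ_l => E.
  rewrite -[X in _ + X <= _]/(1 * true) -E -sum_const_cond -!big_split /=.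
  apply: leq_sum => u Tu; have := no u; rewrite /= Tu /= => /negbT; rewrite -ltnNge.
  by case: (eqVneq u l) => [->|_]; [rewrite tl|]; olia.
have hP : \sum_(u | tailP u) cP u + kP * 2 <= \sum_(u | tailP u) cQ u + kP * ~~ odd i.
  rewrite -!sum_const_cond -!big_split /=.
  by apply: leq_sum => u Tu; apply: tight_l_rich.
have := tail_sum_rel; rewrite !tail_split; have := tail_count; have := kPQ; move: hP hQ.
by case: (odd i) => /=; clear; rewrite ?muln0 ?muln1; lia.
Qed.

Lemma diff_class_false : False.
Proof.
have := bal_P (tailP_cls tailP_i); rewrite leq_eqVlt => /orP[/eqP ti|ri].
  exact: tight_i_false.
have := bal_Q clsQ_l; rewrite leq_eqVlt => /orP[/eqP tl|rl]; first exact: tight_l_false.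
exact: loose_false.
Qed.

End DiffClass.

Lemma core_false : False.
Proof.
by case: (eqVneq (odd n) (odd i)) => li; [exact: same_class_false|exact: diff_class_false].
Qed.

End Core.


(** * Descent to the minimal i *)

Definition nonincreasing n (d : 'I_n -> nat) := forall u v : 'I_n, u <= v -> d v <= d u.

Definition balanced_realizable n (d : 'I_n -> nat) :=
  exists e : rel 'I_n, [/\ simple_graph e, balanced e & forall v, deg e v = d v].

Lemma deg_pick n (e : rel 'I_n) x y : simple_graph e -> deg e y < deg e x ->
  exists e', simple_graph e' /\ forall v, deg e' v + (v == x) = deg e v + (v == y).
Proof.
rewrite -!nbrT => se lt; have [//|w [_ xw yw nw]] := nbr_pick se _ lt.
by exists (move e x w y); split; [apply: move_simple|apply: deg_move].
Qed.

(** Minimality of i takes the form of a descent: as soon as the unit can be placed at some j < i,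
    the induction on the bound m takes over. *)
Lemma raise_and_lower n (d : 'I_n.+1 -> nat) :
  (forall D : 'I_n.+1 -> nat, graphic D -> nonincreasing D ->
    \sum_(v : 'I_n.+1) v * D v < \sum_(v : 'I_n.+1) v * d v -> balanced_realizable D) ->
  nonincreasing d -> 0 < d ord_max -> d ord0 < n ->
  forall m (i : 'I_n.+1) (e : rel 'I_n.+1), i < m -> i < n -> simple_graph e ->
    (forall v, deg e v + (v == ord_max) = d v + (v == i)) -> balanced_realizable d.
Proof.
move=> IHd mono dl d0; elim=> // m IH i e; rewrite ltnS => im iltn se dg.
have pred_inord : (inord i.-1 : 'I_n.+1) = i.-1 :> nat.
  by rewrite inordK //; apply: leq_ltn_trans (leq_pred _) (ltn_ord i).
have nil : (i == ord_max) = false by apply/negbTE; apply: contraTneq iltn => ->; rewrite ltnn.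
(* When i - 1 has the same degree in d, the unit can be shifted to it. So i may be taken first in
   its block of equal degrees, which keeps [deg e] nonincreasing. *)
case: (boolP ((0 < i) && (d (inord i.-1) == d i))) => [/andP[i0 /eqP dj]|top].
  set j : 'I_n.+1 := inord i.-1.
  have ji : j.+1 = i by rewrite /j pred_inord prednK.
  have jlti : j < i by rewrite ji.
  have nji : (j == i) = false by apply/negbTE; apply: contraTneq jlti => ->; rewrite ltnn.
  have njl : (j == ord_max) = false.
    by apply/negbTE; apply: contraTneq (ltn_trans jlti iltn) => ->; rewrite ltnn.
  have lt : deg e j < deg e i.
    have := dg j; have := dg i; rewrite eqxx nji njl nil /j dj !addn0 => -> ->; rewrite addn1; exact: ltnSn.
  have [e' [se' dg']] := deg_pick se lt.
  apply: (IH j e') => //; [exact: leq_trans jlti im|exact: ltn_trans jlti iltn|].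
  by move=> v; have := dg v; have := dg' v; clear; lia.
have dgE v : deg e v = d v + (v == i) - (v == ord_max) by rewrite -dg addnK.
have drop (u : 'I_n.+1) : u < i -> d i < d u.
  move=> ui; have i0 : 0 < i by apply: leq_ltn_trans ui.
  apply: (@leq_trans (d (inord i.-1))); last by apply: mono; rewrite pred_inord -ltnS prednK.
  move: top; rewrite i0 /= => ne; rewrite ltn_neqAle eq_sym ne /=.
  by apply: mono; rewrite pred_inord leq_pred.
have monoD : nonincreasing (deg e).
  move=> u v uv; case: (eqVneq u v) => [->//|nuv].
  have ulv : u < v by rewrite ltn_neqAle nuv uv.
  have nul : (u == ord_max) = false.
    by apply/negbTE; apply: contraTneq ulv => ->; rewrite -leqNgt -ltnS ltn_ord.
  rewrite !dgE nul subn0; apply: leq_trans (leq_subr _ _) _.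
  case: (eqVneq v i) => [vi|_]; last by rewrite addn0; apply: leq_trans (mono _ _ uv) (leq_addr _ _).
  by rewrite vi addn1; apply: leq_trans (leq_addr _ _); apply: drop; rewrite -vi.
have [||G [sG bG dG]] := IHd (deg e) _ monoD.
- by exists e.
- have E1 := sum_indic predT i i; have E2 := sum_indic predT (@ord_max n) n.
  have : \sum_(v : 'I_n.+1) v * (deg e v + (v == ord_max)) = \sum_(v : 'I_n.+1) v * (d v + (v == i)).
    by apply: eq_bigr => v _; rewrite dg.
  under eq_bigr do rewrite mulnDr.
  under [RHS]eq_bigr do rewrite mulnDr.
  rewrite !big_split /=.
  have -> : \sum_(v : 'I_n.+1) v * (v == ord_max) = n.
    by rewrite -[RHS]muln1 -E2; apply: eq_bigr => v _; case: eqVneq => [->|_]; rewrite ?muln0.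
  have -> : \sum_(v : 'I_n.+1) v * (v == i) = i.
    by rewrite -[RHS]muln1 -E1; apply: eq_bigr => v _; case: eqVneq => [->|_]; rewrite ?muln0.
  by move: iltn; clear; lia.
have [sy ir] := sG.
(* A violation of [full] lets h < i take x from b; a second move from i to b restores the degree of
   b, and the unit has descended from i to h. *)
case: (pickP [pred p : 'I_n.+1 * 'I_n.+1 * 'I_n.+1 |
    [&& i <= p.1.2, p.2 < i, p.1.1 != p.2, G p.1.1 p.1.2 & ~~ G p.1.1 p.2]])
  => [[[x b] h] /= /and5P[ib hi nxh xb nxhG]|no].
  have bx : G b x by rewrite sy.
  have hx : ~~ G h x by rewrite sy.
  have nhx : h != x by rewrite eq_sym.
  have [e' [se' dg']] : exists e', simple_graph e' /\
      forall v, deg e' v + (v == i) = deg G v + (v == h).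
    have se1 : simple_graph (move G b x h) by apply: move_simple.
    have d1 := deg_move sG bx hx nhx.
    case: (eqVneq b i) => [<-|bi]; first by exists (move G b x h).
    have lt : deg (move G b x h) b < deg (move G b x h) i.
      have nhb : (b == h) = false by apply/negbTE; apply: contraTneq hi => <-; rewrite -leqNgt.
      have nhi : (i == h) = false by apply/negbTE; apply: contraTneq hi => <-; rewrite ltnn.
      have := d1 b; have := d1 i; rewrite eqxx (eq_sym i b) (negbTE bi) nhb nhi !dG.
      have := monoD _ _ ib; clear; lia.
    have [e' [se' dg']] := deg_pick se1 lt; exists e'; split=> // v.
    by have := dg' v; have := d1 v; clear; lia.
  apply: (IH h e') => //; [exact: leq_trans hi im|exact: ltn_trans hi iltn|].
  by move=> v; have := dg v; have := dg' v; rewrite dG; clear; lia.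
have gl : deg G ord_max = (d ord_max).-1.
  by rewrite dG dgE eqxx eq_sym nil addn0 subn1.
have gi : deg G i = d i + 1 by rewrite dG dgE eqxx nil subn0.
have lmax (v : 'I_n.+1) : v < n -> (v == ord_max) = false.
  by move=> vn; apply/negbTE; apply: contraTneq vn => ->; rewrite ltnn.
have [e' [se' be' dge']] : transfer G i ord_max.
  apply: NNPP => stuck; apply: (@core_false _ G i sG bG iltn) => //.
  - by move=> u v uv; rewrite !dG; apply: monoD.
  - move=> w iw; rewrite gi dG dgE addn1 ltnS; apply: leq_trans (leq_subr _ _) _.
    rewrite (_ : w == i = false) ?addn0; first exact: mono (ltnW iw).
    by apply/negbTE; apply: contraTneq iw => ->; rewrite ltnn.
  - move=> w iw wn; rewrite gl dG dgE lmax // subn0 prednK //.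
    by apply: leq_trans (leq_addr _ _); apply: mono; rewrite ltnW.
  - by rewrite gl gi; have : d ord_max <= d i by [apply: mono; rewrite ltnW]; move: dl; clear; lia.
  - move=> u ui; rewrite dG dgE lmax ?(ltn_trans ui) // subn0.
    rewrite (_ : u == i = false) ?addn0; first by apply: leq_ltn_trans d0; apply: mono.
    by apply/negbTE; apply: contraTneq ui => ->; rewrite ltnn.
  move=> x b h ib hi nxh xb; have := no (x, b, h); rewrite /= ib hi nxh xb /=.
  by move/negbFE.
exists e'; split=> // v; have := dge' v; have := dg v; rewrite dG; clear; lia.
Qed.


(** * Removing an isolated or dominating vertex *)

Definition cone n (h : 'I_n.+1) (c : bool) (f : rel 'I_n) : rel 'I_n.+1 := fun u v =>
  match unlift h u, unlift h v with
  | Some a, Some b => f a b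
  | None, None => false
  | _, _ => c
  end.

Lemma cone_simple n (h : 'I_n.+1) c (f : rel 'I_n) : simple_graph f -> simple_graph (cone h c f).
Proof.
case=> sy ir; split=> [u v|v]; rewrite /cone.
  by case: (unlift h u) => [a|]; case: (unlift h v).
by case: (unlift h v).
Qed.

Lemma nbr_cone_lift n (h : 'I_n.+1) c (f : rel 'I_n) (A : pred 'I_n.+1) j :
  nbr (cone h c f) A (lift h j) = A h * c + nbr f (fun u => A (lift h u)) j.
Proof.
rewrite /nbr big_mkcond (bigD1_ord h) //= [in RHS]big_mkcond; congr (_ + _).
  by rewrite /cone liftK unlift_none; case: (A h); case: c.
by apply: eq_bigr => u _; rewrite /cone !liftK.
Qed.

Lemma nbr_cone_apex n (h : 'I_n.+1) c (f : rel 'I_n) (A : pred 'I_n.+1) :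
  nbr (cone h c f) A h = \sum_(u | A (lift h u)) c.
Proof.
rewrite /nbr big_mkcond (bigD1_ord h) //= [in RHS]big_mkcond /cone unlift_none.
by case: (A h); apply: eq_bigr => u _; rewrite liftK.
Qed.

Lemma deg_restrict n (h : 'I_n.+1) (e : rel 'I_n.+1) j :
  deg e (lift h j) = e (lift h j) h + deg (fun a b => e (lift h a) (lift h b)) j.
Proof. by rewrite -!nbrT /nbr (bigD1_ord h). Qed.

(** The equation [d h = c * n] makes h isolated or dominating in every realization, so deleting it
    lowers all other degrees by the same c and keeps their order. *)
Lemma cone_realizable n (h : 'I_n.+1) (c : bool) (d : 'I_n.+1 -> nat) :
  (forall f : rel 'I_n, balanced f -> balanced (cone h c f)) ->
  (forall D : 'I_n -> nat, graphic D -> nonincreasing D -> balanced_realizable D) ->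
  graphic d -> nonincreasing d -> d h = c * n -> balanced_realizable d.
Proof.
move=> hb IH [e [se dg]] mono dh; have [sy ir] := se.
have eh j : e (lift h j) h = c.
  have : \sum_(j : 'I_n) (e h (lift h j) : nat) = c * n.
    by rewrite -dh -dg -nbrT /nbr (bigD1_ord h) //= (negbTE (ir h)).
  rewrite sy; case: c {hb dh} => E.
    apply/negPn/negP => nj; have := sum_indic predT j 1; rewrite /= => E1.
    have : \sum_(j : 'I_n) (e h (lift h j) : nat) + 1 <= \sum_(j < n) 1.
      rewrite -[X in _ + X <= _]/(1 * true) -E1 -big_split /=; apply: leq_sum => u _.
      by case: eqVneq => [->|_]; rewrite ?(negbTE nj) //; case: (e h _).
    by rewrite E mul1n sum1_card card_ord addn1 ltnn.
  by move/eqP: E; rewrite sum_nat_eq0 => /forallP/(_ j); case: (e h _).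
have dgr j : d (lift h j) = c + deg (fun a b => e (lift h a) (lift h b)) j.
  by rewrite -dg deg_restrict eh.
have [||f [sf bf df]] := IH (fun j => d (lift h j) - c).
- exists (fun a b => e (lift h a) (lift h b)); split; last by move=> j; rewrite dgr addKn.
  by split=> [u v|v]; [apply: sy|apply: ir].
- move=> u v uv; rewrite leq_sub2r //; apply: mono.
  by rewrite /= /bump; case: (leqP h u) => hu; case: (leqP h v) => hv; move: hu hv uv; clear; lia.
exists (cone h c f); split; [exact: cone_simple|exact: hb|].
move=> v; rewrite -nbrT; case: (unliftP h v) => [j|] ->.
  by rewrite nbr_cone_lift mul1n nbrT df dgr addKn.
by rewrite nbr_cone_apex dh sum_nat_const card_ord mulnC.
Qed.

Lemma balanced_cone_first n (f : rel 'I_n) : balanced f -> balanced (cone ord0 true f).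
Proof.
move=> bf v; rewrite /same /cross; case: (unliftP ord0 v) => [j|] ->.
  rewrite !nbr_cone_lift.
  have E o : nbr f (fun u => cls o (lift ord0 u)) j = nbr f (cls (~~ o)) j.
    by apply: eq_bigl => u; rewrite /cls lift0 /=; case: (odd u); case: o.
  rewrite !E lift0 /= !negbK; have := bf j; rewrite /same /cross /cls /=.
  by case: (odd j) => /=; clear; lia.
rewrite !nbr_cone_apex /cls /=.
have conv (P : pred nat) : \sum_(u : 'I_n | P u) 1 = \sum_(0 <= j < 0 + n | P j) 1 by rewrite big_mkord.
have /andP[h _] := @parity_sum_nat (fun=> 1) 0 n (fun _ _ _ => leqnn _).
rewrite -(conv (fun j => odd j != false)) -(conv (fun j => odd j == false)) /= in h.
apply: leq_trans (leq_trans _ h) (leq_trans _ (leq_addr _ _)); apply: eq_leq;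
  by apply: eq_bigl => u; rewrite add0n; case: (odd u).
Qed.

Lemma balanced_cone_last n (f : rel 'I_n) : balanced f -> balanced (cone ord_max false f).
Proof.
move=> bf v; rewrite /same /cross; case: (unliftP ord_max v) => [j|] ->.
  rewrite !nbr_cone_lift !muln0 lift_max; have := bf j.
  have E o : nbr f (fun u => cls o (lift ord_max u)) j = nbr f (cls o) j.
    by apply: eq_bigl => u; rewrite /cls lift_max.
  by rewrite !E.
by rewrite !nbr_cone_apex !big1.
Qed.

(** * Double induction and conclusion *)

Lemma graphic_balanced n (d : 'I_n -> nat) :
  graphic d -> nonincreasing d -> balanced_realizable d.
Proof.
elim: n d => [|n IHn] d; first by case=> e [se dg] _; exists e; split=> // -[].
have [m] := ubnP (\sum_(v : 'I_n.+1) v * d v); elim: m d => // m IHm d lem gd mono.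
have [e [se dg]] := gd; have [sy ir] := se.
case: (posnP (d ord_max)) => [dl|dl].
  by apply: (cone_realizable (@balanced_cone_last n) IHn gd mono); rewrite dl.
have dlt v : d v <= n.
  have := sum_indic predT v 1; rewrite -dg -nbrT /= => E.
  have : nbr e predT v + 1 <= \sum_(u : 'I_n.+1) 1.
    rewrite -[X in _ + X <= _]/(1 * true) -E -big_split /=; apply: leq_sum => u _.
    by case: eqVneq => [->|_]; rewrite ?(negbTE (ir v)) //; case: (e v u).
  by rewrite sum1_card card_ord addn1.
case: (ltnP (d ord0) n) => d0; last first.
  apply: (cone_realizable (@balanced_cone_first n) IHn gd mono).
  by rewrite mul1n; apply/eqP; rewrite eqn_leq dlt d0.
(* Start of the descent: the last vertex has a neighbour x, which is not dominating and so misses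
   some h; moving the edge from the last vertex to h gives a first admissible index. *)
have [x _ lx] : exists2 x, predT x & e ord_max x by apply: nbr_gt0; rewrite nbrT dg.
have [h nhx xh] : exists2 h, h != x & ~~ e x h.
  case: (pickP [pred h | (h != x) && ~~ e x h]) => [h /andP[]|no]; first by exists h.
  have : \sum_(u : 'I_n.+1) 1 <= nbr e predT x + 1.
    have := sum_indic predT x 1; rewrite /= => E.
    rewrite -[X in _ <= _ + X]/(1 * true) -E -big_split /=; apply: leq_sum => u _.
    by have := no u; rewrite /=; case: eqVneq => [_ _|_ /= /negbFE ->]; rewrite // addnC.
  rewrite sum1_card card_ord nbrT dg addn1 ltnS.
  by move=> /leq_ltn_trans/(_ (leq_ltn_trans (mono ord0 x (leq0n _)) d0)); rewrite ltnn.
have hx : ~~ e h x by rewrite sy.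
have hn : h < n.
  rewrite ltn_neqAle -ltnS ltn_ord andbT; apply: contraNneq hx => hn.
  by rewrite (_ : h = ord_max) //; apply: val_inj.
have IHd (D : 'I_n.+1 -> nat) : graphic D -> nonincreasing D ->
    \sum_(v : 'I_n.+1) v * D v < \sum_(v : 'I_n.+1) v * d v -> balanced_realizable D.
  by move=> gD mD lt; apply: IHm => //; apply: leq_trans lt _; rewrite -ltnS.
apply: (@raise_and_lower _ d IHd mono dl d0 n h (move e ord_max x h)) => //.
  exact: move_simple.
by move=> v; rewrite deg_move // dg.
Qed.

Theorem theorem1p1 (n : nat) (d : 'I_n -> nat) :
  graphic d ->
  (forall i j : 'I_n, (i <= j)%N -> (d j <= d i)%N) ->
  exists e : rel 'I_n,
    simple_graph e /\
    (forall i, deg e i = d i) /\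
    (forall i, (deg e i <= 2 * deg (parity_bisection e) i + 1)%N).
Proof.
move=> gd mono; have [e [se be dg]] := graphic_balanced gd mono.
exists e; split=> //; split=> // v.
have -> : deg (parity_bisection e) v = cross e v.
  rewrite -nbrT /nbr big_mkcond /cross /nbr [RHS]big_mkcond; apply: eq_bigr => u _.
  by rewrite /parity_bisection /cls; case: (e v u); case: (odd u); case: (odd v).
by rewrite deg_cls; have := be v; case: (odd v) => /=; clear; lia.
Qed.
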